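(* Let $n\ge1$ be an integer, let $\bm\xi=(\xi^1,\dots,\xi^n)\in(\mathbb R/\mathbb Z)^n$, let $\bm\tau=(\tau^1,\dots,\tau^n)\in\mathbb R^n$ and let $\bm\sigma=(\sigma^1,\dots,\sigma^n)$ with $\sigma^j>0$ for all $j$, all fixed independently of $d$. For each $d\ge2$ let $\mathbb P^{(d)}_{n,\bm\sigma,\Xi,\bm\tau/\Xi}$ be the limiting distribution on $\mathbb Z_{\ge 0}^n$ defined in the context. Then $\mathbb P^{(d)}_{n,\bm\sigma,\Xi,\bm\tau/\Xi}$ has a weak limit as $d\to\infty$. Furthermore, $$\mathbb P^{(d)}_{n,\bm\sigma,\Xi,\bm\tau/\Xi}\Longrightarrow(\mathrm{Pois}\,\sigma^1,\dots,\mathrm{Pois}\,\sigma^n)\quad\text{as } d\to\infty$$ (weak convergence to the law of a vector of independent Poisson random variables with parameters $\sigma^1,\dots,\sigma^n$) if and only if $$(\tau^j,\tau^j+\sigma^j)\cap(\tau^{j'},\tau^{j'}+\sigma^{j'})=\emptyset\quad\text{whenever } j\ne j' \text{ and } \xi^j=\xi^{j'}.$$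
   Context: For integers $N\ge 1$, $d\ge2$ let $B_N=(0,N^{1/(d-1)}]^{d-1}\times\mathbb R\subset\mathbb R^d$. For $\xi\in\mathbb R/\mathbb Z$ (identified with any real representative; the choice does not matter) and a measurable set $S\subset\mathbb R$, define the function of $\bm\alpha=(\alpha_1,\dots,\alpha_{d-1})\in[0,1)^{d-1}$ $$X^{N,d}_{\xi,S}(\bm\alpha)=\#\Bigl\{\bm m=(m_1,\dots,m_d)\in\mathbb Z^d\cap B_N:\ \sum_{i=1}^{d-1}m_i\alpha_i+m_d\in \xi+\tfrac{S}{N}\Bigr\}.$$ Let $\Xi=\overline{\{k\bm\xi: k\in\mathbb Z\}}\subset\mathbb T^n=(\mathbb R/\mathbb Z)^n$. When $\bm\alpha$ is distributed according to an absolutely continuous probability measure on $[0,1)^{d-1}$, the random vector $\bigl(X^{N,d}_{\xi^1,(\tau^1,\tau^1+\sigma^1)},\dots,X^{N,d}_{\xi^n,(\tau^n,\tau^n+\sigma^n)}\bigr)$ converges in distribution as $N\to\infty$, and the limit does not depend on the choice of the absolutely continuous measure; this limit is denoted $\mathbb P^{(d)}_{n,\bm\sigma,\Xi,\bm\tau/\Xi}$ (the notation records that it depends on $\bm\xi$ only through $\Xi$). $\mathrm{Pois}\,\sigma$ denotes the Poisson distribution with parameter $\sigma$, giving mass $e^{-\sigma}\sigma^k/k!$ to each $k\in\mathbb Z_{\ge0}$. *)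

(* Defs.v *)
From HB Require Import structures.
From mathcomp Require Export all_boot all_order all_algebra.
From mathcomp Require Export finmap.
From mathcomp Require Export all_classical all_reals all_analysis.
Export Order.TTheory GRing.Theory Num.Theory.
Export numFieldNormedType.Exports.

Set Implicit Arguments.
Unset Strict Implicit.
Unset Printing Implicit Defensive.

Local Open Scope classical_set_scope.
Local Open Scope ring_scope.

Section ProductProbability.
Context (R : realType) (disp : measure_display) (T : measurableType disp).

Definition cons_pair n (x : T * n.-tuple T) : n.+1.-tuple T :=
  [tuple of x.1 :: x.2].

Lemma measurable_cons_pair n : measurable_fun setT (@cons_pair n).
Proof. exact: measurable_cons. Qed.

HB.instance Definition _ n :=
  isMeasurableFun.Build _ _ _ _ (@cons_pair n) (@measurable_cons_pair n).

Fixpoint tuple_prob n : ('I_n -> probability T R) -> probability (n.-tuple T) R :=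
  match n with
  | 0 => fun _ => \d_([tuple] : 0.-tuple T)
  | n'.+1 => fun P =>
      distribution (P ord0 \x tuple_prob (fun i => P (lift ord0 i)))%E
        (@cons_pair n' : {mfun _ >-> _})
  end.

(* The measure built above is the product measure. *)
Lemma tuple_prob_box n (P : 'I_n -> probability T R) (A : 'I_n -> set T) :
  (forall i, measurable (A i)) ->
  tuple_prob P [set t | forall i, A i (tnth t i)] = (\prod_(i < n) P i (A i))%E.
Proof.
elim: n P A => [|n IH] P A mA.
  rewrite big_ord0 /= diracE mem_set//=.
  by move=> i; case: i.
rewrite big_ord_recl -(IH (fun i => P (lift ord0 i)) (fun i => A (lift ord0 i)))//.
have mB : measurable
    [set t : n.-tuple T | forall i, A (lift ord0 i) (tnth t i)].
  rewrite (_ : [set t | _] = \big[setI/setT]_(i < n)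
      ((fun t : n.-tuple T => tnth t i) @^-1` A (lift ord0 i))).
    apply: bigsetI_measurable => i _; rewrite -[X in measurable X]setTI.
    by apply: measurable_tnth.
  apply/seteqP; split=> t /=; rewrite -bigcap_seq /=.
    by move=> h i _; exact: h.
  by move=> h i; apply: (h i) => /=; rewrite mem_index_enum.
rewrite -product_measure1E// /= /distribution /pushforward; congr (_ _).
apply/seteqP; split=> -[x t] /=.
  move=> h; split; first by have := h ord0; rewrite tnth0.
  by move=> i; have := h (lift ord0 i); rewrite tnthS.
move=> [h0 h] i; case: (unliftP ord0 i) => [j ->|->].
  by rewrite tnthS; exact: h.
by rewrite tnth0.
Qed.

End ProductProbability.

Section Definitions.
Context (R : realType).

Definition box (d N : nat) : set (d.-1.-tuple R * R) :=
  [set x | forall i, 0 < tnth x.1 i <= N%:R `^ (d.-1%:R)^-1].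

(* The points (m_1, ..., m_d) of Z^d are written ((m_1, ..., m_(d-1)), m_d). *)
Definition embed (d : nat) (m : d.-1.-tuple int * int) : d.-1.-tuple R * R :=
  ([tuple of map intr m.1], m.2%:~R).

Definition hits (d N : nat) (xi : R) (S : set R) (alpha : d.-1.-tuple R) :
    set (d.-1.-tuple int * int) :=
  [set m | box N (embed m) /\
     [set xi + s / N%:R | s in S]
       (\sum_(i < d.-1) (tnth m.1 i)%:~R * tnth alpha i + m.2%:~R)].

(* [xi] represents a point of R/Z; the coordinate m_d absorbs integer shifts.
   [fset_set A] is empty when [A] is infinite; this does not occur for N > 0
   and S bounded. *)
Definition hit_count (d N : nat) (xi : R) (S : set R)
    (alpha : d.-1.-tuple R) : nat :=
  #|` fset_set (hits N xi S alpha)|.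

Definition hit_count_vec (d n N : nat) (xi tau sigma : 'I_n -> R)
    (alpha : d.-1.-tuple R) : n.-tuple nat :=
  [tuple hit_count N (xi j) `]tau j, (tau j + sigma j)[ alpha | j < n].

(* Lebesgue measure on the unit cube; [uniform_prob] lives on [0, 1], which
   agrees with [0, 1) up to a null set. *)
Definition lebesgue_cube (D : nat) : probability (D.-tuple (measurableTypeR R)) R :=
  tuple_prob (fun=> uniform_prob (@ltr01 R)).

(* The weak topology is tested on bounded continuous functions; every function
   on the discrete space n.-tuple nat is continuous (and measurable). *)
Definition bounded_test (n : nat) (f : n.-tuple nat -> R) : Prop :=
  exists M : R, forall k, `|f k| <= M.

Definition weak_cvg (n : nat) (P : nat -> probability (n.-tuple nat) R)
    (Q : probability (n.-tuple nat) R) : Prop :=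
  forall f, bounded_test f ->
    (\int[P d]_k (f k)%:E)%E @[d --> \oo] --> (\int[Q]_k (f k)%:E)%E.

Definition cvg_in_distribution (disp : measure_display)
    (T : measurableType disp) (lambda : probability T R) (n : nat)
    (Y : nat -> T -> n.-tuple nat) (Q : probability (n.-tuple nat) R) : Prop :=
  forall f, bounded_test f ->
    (\int[lambda]_x (f (Y N x))%:E)%E @[N --> \oo] --> (\int[Q]_k (f k)%:E)%E.

(* Domination by [lebesgue_cube] expresses both absolute continuity and being
   carried by the unit cube. *)
Definition limit_distribution (d n : nat) (xi tau sigma : 'I_n -> R)
    (Q : probability (n.-tuple nat) R) : Prop :=
  forall lambda : probability (d.-1.-tuple (measurableTypeR R)) R,
    lambda `<< lebesgue_cube d.-1 ->
    cvg_in_distribution lambda (fun N => @hit_count_vec d n N xi tau sigma) Q.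

(* The last argument of [poisson_prob] is a dummy. *)
Definition poisson_vec (n : nat) (sigma : 'I_n -> R) :
    probability (n.-tuple nat) R :=
  tuple_prob (fun j => poisson_prob (sigma j) 0%N).

End Definitions.

(* Main.v *)
From HB Require Import structures.
Require Import Defs.
From mathcomp Require Import zify ring lra measurable_realfun.

(** Write D for d - 1 and L for the integral part of the D-th root of N. The
    generating function of the count vector at z in [0, 1]^n is the mean of a
    product over the vectors m of {1, ..., L}^D of factors 1 - g(m . alpha),
    where g is 1-periodic with values in [0, 1] and c = N * (mean of g) is at
    most the sum of the sigma_j ([pgf_hit_count_vec], [mean_weight_le]). By
    Bonferroni's inequalities ([bonferroni]) this product lies between
    alternating sums of the elementary symmetric functions of the g(m . alpha),
    so it suffices to see that the k-th one has mean close to c^k / k!; then the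
    generating function is close to exp(- c).

    If m_1, ..., m_k are linearly independent, the values m_i . alpha are
    independent and uniform modulo 1 ([integral_prod_lin_value]), and the set
    {m_1, ..., m_k} contributes exactly the k-th power of the mean of g. A set of
    rank r contributes at most the r-th power, which is of order N^-r. Hence it
    remains to count the k-tuples of distinct vectors of rank r < k and to see
    that they are few compared with N^r: this is where d must be large
    ([card_dependent]). The k x D matrix with rows m_1, ..., m_k is C times the
    submatrix of r independent rows, and, since the rows are distinct, some row
    of C is not a unit vector. A column of the matrix is determined by its
    entries in the r rows; these form a point of {1, ..., L}^r at which the
    linear forms given by C take values in {1, ..., L}. The proportion of such
    points is at most 8/9, and at most 2/h if C has an entry of height h <= L.
    Raising this to the power D makes the sum over all C small.

    So for large d the generating function of the limit law in dimension d is
    close to exp(- c), where c depends on N but not on d ([pgf_approx]); it is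
    therefore a Cauchy sequence in d. Indicators of points are uniform limits of
    linear combinations of the functions x |-> \prod_j z_j ^ x_j
    ([mean_closed_points]), hence the point masses converge, and tightness
    yields a weak limit ([weak_limit_of_pgf]). If intervals with xi equal modulo 1 are
    disjoint, then for large N the corresponding arcs of the circle are disjoint
    and c is exactly the exponent of the Poisson generating function. If the
    intervals of j and j' overlap in length l, take z = 0 at j and j' and z = 1
    elsewhere: c is then at most sigma_j + sigma_j' - l, so in the limit both
    counts vanish with a probability larger than for independent Poisson
    variables. *)

Set Implicit Arguments.
Unset Strict Implicit.
Unset Printing Implicit Defensive.

Local Open Scope ring_scope.

(** * Counting linearly dependent tuples of lattice vectors *)

(** On a line parallel to the i-th axis, the values of w at the points of P are
    congruent modulo h and determine the points, so w %/ h does as well.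
    Replacing the i-th coordinate by this quotient is an injection of P into a
    product of intervals. *)
Lemma card_line_cover r L (P : {pred {ffun 'I_r -> 'I_L}}) (i : 'I_r) (h : nat)
    (w : {ffun 'I_r -> 'I_L} -> nat) :
  (0 < h)%N -> {in P, forall u, (w u < L)%N} ->
  {in P &, forall u u' : {ffun 'I_r -> 'I_L}, (forall j, j != i -> u j = u' j) ->
     (w u = w u' %[mod h])%N /\ (w u = w u' -> u i = u' i)} ->
  (#|P| <= L ^ r.-1 * (L.-1 %/ h).+1)%N.
Proof.
move=> h0 wL wP.
case: L P w wL wP => [|L] P w wL wP.
  rewrite eq_card0 // => u; apply/negP => uP; have := wL _ uP; by rewrite ltn0.
pose F (j : 'I_r) : {pred 'I_L.+1} :=
    if j == i then [pred v : 'I_L.+1 | (v <= L %/ h)%N] else predT.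
pose phi (u : {ffun 'I_r -> 'I_L.+1}) : {ffun 'I_r -> 'I_L.+1} :=
  [ffun j => if j == i then inord (w u %/ h) else u j].
have wh u : u \in P -> (w u %/ h < L.+1)%N.
  by move=> uP; apply: leq_ltn_trans (leq_div _ _) (wL _ uP).
have phi_inj : {in P &, injective phi}.
  move=> u u' uP u'P /ffunP E.
  have ag j : j != i -> u j = u' j.
    by move=> ji; have := E j; rewrite !ffunE (negbTE ji).
  have [cong wi] := wP _ _ uP u'P ag.
  have Ei : (w u %/ h = w u' %/ h)%N.
    by have := E i; rewrite !ffunE eqxx => /(congr1 val) /=; rewrite !inordK ?wh.
  apply/ffunP => j; case: (eqVneq j i) => [->|]; last exact: ag.
  by apply: wi; rewrite (divn_eq (w u) h) (divn_eq (w u') h) Ei cong.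
rewrite -(card_in_image phi_inj).
have sub : {subset [seq phi x | x in P] <= family F}.
  move=> f /fintype.imageP[u uP ->] {f}; apply/familyP => j; rewrite ffunE /F.
  case: ifP => // _; rewrite inE inordK ?wh //.
  by apply: leq_div2r; rewrite -ltnS wL.
have {}sub : (#|[seq phi x | x in P]| <= #|family F|)%N by apply: subset_leq_card;
    apply/fintype.subsetP.
apply: (leq_trans sub).
rewrite card_family foldrE big_image /= (bigD1 i) //=.
move=> {sub}.
have -> : (\prod_(j < r | j != i) #|F j| = L.+1 ^ r.-1)%N.
  rewrite (eq_bigr (fun=> L.+1)); last by move=> j /negbTE ji; rewrite /F ji card_ord.
  by rewrite prod_nat_const cardC1 card_ord.
rewrite mulnC leq_mul2l; apply/orP; right; rewrite /F eqxx.
set q := (L %/ h)%N.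
have inj : {in [pred v : 'I_L.+1 | (v <= q)%N] &, injective (fun v : 'I_L.+1 =>
    inord v : 'I_q.+1)}.
  move=> v v'; rewrite !inE => vq v'q /(congr1 val) /=.
  by rewrite !inordK // => /val_inj.
by rewrite -(card_in_image inj); apply: leq_trans (max_card _) _; rewrite card_ord.
Qed.

(** An element i of ['I_L] stands for the coordinate i + 1, so that ['I_L] plays
    the role of {1, ..., L}. *)
Definition lin_form r L (c : 'I_r -> rat) (u : {ffun 'I_r -> 'I_L}) : rat :=
  \sum_i c i * (u i).+1%:R.

Definition box_slice r L (c : 'I_r -> rat) : {set {ffun 'I_r -> 'I_L}} :=
  [set u | [exists w : 'I_L, lin_form c u == w.+1%:R]].

Definition height (x : rat) : nat := maxn `|numq x| `|denq x|.

Lemma dvdn_dist_mod (h x y : nat) : (h %| `|x%:Z - y%:Z|)%N -> x = y %[mod h].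
Proof.
move=> d; apply/eqP; rewrite -eqz_nat -!modz_nat eqz_mod_dvd.
by rewrite dvdzE.
Qed.

Lemma lin_form_diff r L (c : 'I_r -> rat) (i : 'I_r) (u u' : {ffun 'I_r -> 'I_L}) :
  (forall j, j != i -> u j = u' j) ->
  lin_form c u - lin_form c u' = c i * ((u i)%:R - (u' i)%:R).
Proof.
move=> ag; rewrite /lin_form (bigD1 i) //= [X in _ - X](bigD1 i) //=.
rewrite (eq_bigr (fun j => c j * (u' j).+1%:R)); last by move=> j /ag ->.
by rewrite -!natr1; ring.
Qed.

(** Write the i-th coefficient as p / q in lowest terms. Along the i-th axis,
    two points of the slice differ by a multiple of q and the values of the form
    by a multiple of p. So the larger of |p| and q spaces out either the points
    or the values, and both lie in {1, ..., L}. *)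
Lemma card_slice_height r L (c : 'I_r -> rat) (i : 'I_r) :
  (#|box_slice L c| <= L ^ r.-1 * (L.-1 %/ height (c i)).+1)%N.
Proof.
pose y (u : {ffun 'I_r -> 'I_L}) : nat :=
  oapp val 0%N [pick w : 'I_L | lin_form c u == w.+1%:R].
have yE u : u \in box_slice L c -> lin_form c u = (y u).+1%:R /\ (y u < L)%N.
  rewrite inE /y => /existsP[w0 /eqP wE]; case: pickP => [w /eqP -> /=|/(_ w0)].
    by split=> //; exact: ltn_ord.
  by rewrite /= wE eqxx.
have key u u' : u \in box_slice L c -> u' \in box_slice L c ->
    (forall j, j != i -> u j = u' j) ->
    numq (c i) * ((u i)%:Z - (u' i)%:Z) = denq (c i) * ((y u)%:Z - (y u')%:Z).
  move=> /yE[uE _] /yE[u'E _] /(lin_form_diff c); rewrite uE u'E => E.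
  have : (c i * (denq (c i))%:~R) * ((u i)%:R - (u' i)%:R) =
     (denq (c i))%:~R * ((y u)%:R - (y u')%:R).
    by rewrite -!natr1 in E; rewrite mulrAC -E; ring.
  rewrite [X in X * _](_ : _ = (numq (c i))%:~R); last first.
    by rewrite -{1}(divq_num_den (c i)) divfK // intr_eq0 denq_neq0.
  rewrite !pmulrn -!intrB -!intrM => /intr_inj //.
have cop := coprime_num_den (c i).
have d0 : (0 < `|denq (c i)|)%N by rewrite absz_gt0 denq_neq0.
have modE (a b x x' z z' : int) : coprime `|a| `|b| -> a * (x - x') = b * (z - z') ->
    (`|b| %| `|x - x'|)%N.
  move=> cab E; rewrite -(@Gauss_dvdr _ `|a|) 1?coprime_sym // -abszM E abszM.
  exact: dvdn_mulr.
rewrite /height; case: (leqP `|numq (c i)| `|denq (c i)|) => [_|gt].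
- apply: (@card_line_cover _ _ _ i _ (fun u => val (u i))) => // [u|u u'] /=;
    first by rewrite ltn_ord.
  move=> us u's ag; split; last by move/val_inj.
  by apply: dvdn_dist_mod; apply: modE cop (key _ _ us u's ag).
- apply: (@card_line_cover _ _ _ i _ y) => // [|u /yE[] //|u u' us u's ag].
    exact: leq_trans gt.
  have n0 : numq (c i) != 0 by rewrite -absz_eq0 -lt0n (leq_trans _ gt).
  split.
    apply: dvdn_dist_mod; apply: modE (esym (key _ _ us u's ag)).
    by rewrite coprime_sym.
  move=> yy; have := key _ _ us u's ag; rewrite yy subrr mulr0 => /eqP.
  by rewrite mulf_eq0 (negbTE n0) /= subr_eq0 eqz_nat => /eqP/val_inj.
Qed.

Lemma card_ord_lt n m : (m <= n)%N -> #|[pred v : 'I_n | (v < m)%N]| = m.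
Proof.
move=> mn.
have inj : injective (widen_ord mn) by move=> x y /(congr1 val) /= /val_inj.
rewrite -[RHS]card_ord -(fintype.card_image inj); apply: eq_card => v; rewrite inE.
apply/idP/fintype.imageP => [vm|[x _ ->]]; last by rewrite /= ltn_ord.
by exists (Ordinal vm) => //; apply: val_inj.
Qed.

Lemma card_ord_ge n m : (m <= n)%N -> #|[pred v : 'I_n | (n - m <= v)%N]| = m.
Proof.
move=> mn; rewrite -[RHS](card_ord_lt mn) -(fintype.card_image (@rev_ord_inj n)).
apply: eq_card => v; rewrite [in RHS]inE.
apply/fintype.imageP/idP => [[x]|vm].
  by rewrite inE => xm -> /=; have := ltn_ord x; lia.
exists (rev_ord v); last by rewrite rev_ordK.
by rewrite inE /=; have := ltn_ord v; lia.
Qed.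

(** Moving the coordinates i1 and i2 by t >= L / 2 each, in the directions in
    which the form increases, raises the form by 2 t >= L. Hence a point and its
    translate are not both in the slice, and each of the points that can be
    moved accounts for a point outside of the slice. *)
Lemma card_slice_pair r L (c : 'I_r -> rat) (i1 i2 : 'I_r) : i1 != i2 ->
  c i1 = 1 \/ c i1 = -1 -> c i2 = 1 \/ c i2 = -1 ->
  (#|box_slice L c| + L./2 ^ 2 * L ^ r.-2 <= L ^ r)%N.
Proof.
move=> i12 c1 c2.
case: L => [|L]; first by rewrite mul0n addn0; apply: leq_trans (max_card _) _;
    rewrite card_ffun !card_ord.
set H := L.+1./2; set t := (L.+1 - H)%N.
have Ht : (H <= t)%N by rewrite /t /H -[X in (_ <= X - _)%N](odd_double_half L.+1) -addnn; lia.
have HL : (H <= L.+1)%N by rewrite /H -[X in (_ <= X)%N](odd_double_half L.+1) -addnn; lia.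
have tL : (L.+1 = t + H)%N by rewrite subnK.
pose low (s : bool) : {pred 'I_L.+1} :=
  if s then [pred v : 'I_L.+1 | (v < H)%N] else [pred v : 'I_L.+1 | (L.+1 - H <= v)%N].
pose sh (s : bool) (v : 'I_L.+1) : 'I_L.+1 :=
    inord (if s then nat_of_ord v + t else nat_of_ord v - t)%N.
have card_low s : #|low s| = H by case: s; rewrite ?card_ord_lt ?card_ord_ge.
have shE s v : v \in low s -> (sh s v : nat) =
    if s then (nat_of_ord v + t)%N else (nat_of_ord v - t)%N.
  case: s; rewrite inE /sh => vl; rewrite inordK //; first by move: vl => /=; lia.
  by rewrite ltnS leq_subLR; have := ltn_ord v; lia.
have sh_notin s v : v \in low s -> sh s v \notin low s.
  by move=> vl; have := shE _ _ vl; case: s vl; rewrite !inE /= => vl ->; have := ltn_ord v;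
      lia.
have sh_inj s : {in low s &, injective (sh s)}.
  move=> v v' vl v'l E; apply: val_inj => /=; have := shE _ _ vl; rewrite E shE //.
  by case: s vl v'l {E}; rewrite !inE => vl v'l; lia.
have sh_diff (x : rat) v : x = 1 \/ x = -1 -> v \in low (x == 1) -> 
   x * ((sh (x == 1) v)%:R - v%:R) = t%:R.
  move=> [->|->] vl; rewrite (shE _ _ vl).
    by rewrite eqxx natrD; ring.
  move: vl; rewrite [_ == _](_ : _ = false) // inE => vl.
  by rewrite natrB //; ring.
pose F (j : 'I_r) : {pred 'I_L.+1} :=
  if j == i1 then low (c i1 == 1) else if j == i2 then low (c i2 == 1) else predT.
pose phi (u : {ffun 'I_r -> 'I_L.+1}) : {ffun 'I_r -> 'I_L.+1} :=
  [ffun j => if j == i1 then sh (c i1 == 1) (u j) else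
             if j == i2 then sh (c i2 == 1) (u j) else u j].
have F1 u : u \in family F -> u i1 \in low (c i1 == 1).
  by move=> /familyP/(_ i1); rewrite /F eqxx.
have F2 u : u \in family F -> u i2 \in low (c i2 == 1).
  by move=> /familyP/(_ i2); rewrite /F eqxx (eq_sym i2 i1) (negbTE i12).
have phi_notin u : u \in family F -> phi u \notin family F.
  move=> uF; apply/negP => /F1; rewrite ffunE eqxx; apply/negP.
  exact/sh_notin/F1.
have phi_inj : {in family F &, injective phi}.
  move=> u u' uF u'F /ffunP E; apply/ffunP => j; have := E j; rewrite !ffunE.
  case: (eqVneq j i1) => [->|_]; first by apply: sh_inj; exact: F1.
  by case: (eqVneq j i2) => [->|_] //; apply: sh_inj; exact: F2.
have gen (a b x x' y y' S T : rat) : a * (x' - x) = T -> b * (y' - y) = T ->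
    a * (x' + 1) + (b * (y' + 1) + S) = a * (x + 1) + (b * (y + 1) + S) + T + T.
  by move=> E1 E2; rewrite -{1}E1 -E2; ring.
have phi_slice u : u \in family F -> u \in box_slice L.+1 c -> phi u \notin box_slice L.+1 c.
  move=> uF; rewrite !inE => /existsP[w /eqP wE]; apply/negP => /existsP[w' /eqP w'E].
  have : lin_form c (phi u) = lin_form c u + t%:R + t%:R.
    rewrite /lin_form (bigD1 i1) //= (bigD1 i2) 1?eq_sym //=.
    rewrite [in RHS](bigD1 i1) //= [in RHS](bigD1 i2) 1?eq_sym //=.
    have -> : \sum_(i < r | (i != i1) && (i != i2)) c i * (phi u i).+1%:R =
       \sum_(i < r | (i != i1) && (i != i2)) c i * (u i).+1%:R.
      by apply: eq_bigr => j /andP[/negbTE j1 /negbTE j2]; rewrite ffunE j1 j2.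
    rewrite !ffunE eqxx (eq_sym i2 i1) (negbTE i12) eqxx -!natr1.
    exact: gen (sh_diff _ _ c1 (F1 _ uF)) (sh_diff _ _ c2 (F2 _ uF)).
  rewrite wE w'E -!natrD => /eqP; rewrite eqr_nat => /eqP E.
  by have := ltn_ord w'; have := ltn_ord w; lia.
(* From each pair made of u and its translate, psi picks a point outside of the
   slice. *)
pose psi u := if u \in box_slice L.+1 c then phi u else u.
have psi_inj : {in family F &, injective psi}.
  move=> u u' uF u'F; rewrite /psi; case: ifP => us; case: ifP => u's //.
  - exact: phi_inj.
  - by move=> E; have := phi_notin _ uF; rewrite E u'F.
  - by move=> E; have := phi_notin _ u'F; rewrite -E uF.
have -> : (H ^ 2 * L.+1 ^ r.-2 = #|family F|)%N.
  rewrite card_family foldrE big_image /= (bigD1 i1) //= (bigD1 i2) 1?eq_sym //=.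
  rewrite mulnA; congr (_ * _)%N.
    by rewrite /F eqxx (eq_sym i2 i1) (negbTE i12) eqxx !card_low.
  rewrite (eq_bigr (fun=> L.+1)); last first.
    by move=> j /andP[/negbTE j1 /negbTE j2]; rewrite /F j1 j2 card_ord.
  rewrite prod_nat_const; congr (_ ^ _)%N.
  have -> : r.-2 = #|~: [set i1; i2]|.
    by have := cardsC [set i1; i2]; rewrite cards2 i12 card_ord /=; lia.
  by apply: eq_card => j; rewrite !inE negb_or.
have -> : (L.+1 ^ r = #|{ffun 'I_r -> 'I_L.+1}|)%N by rewrite card_ffun !card_ord.
rewrite -(cardsC (box_slice L.+1 c)) leq_add2l -(card_in_image psi_inj).
apply: subset_leq_card; apply/fintype.subsetP => f /fintype.imageP[u uF ->] {f}.
rewrite inE /psi; case: ifP => us; last by rewrite us.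
exact: phi_slice.
Qed.

Lemma height_gt0 x : (0 < height x)%N.
Proof. by rewrite leq_max !absz_gt0 denq_neq0 orbT. Qed.

Lemma height_le1 x : (height x <= 1)%N -> [\/ x = 0, x = 1 | x = -1].
Proof.
rewrite geq_max => /andP[n1 d1].
have d : denq x = 1 by have := denq_gt0 x; lia.
rewrite -(divq_num_den x) d divr1.
have : numq x = 0 \/ numq x = 1 \/ numq x = -1 by lia.
by move=> [->|[->|->]]; [constructor 1|constructor 2|constructor 3].
Qed.

Lemma card_slice_le r L (c : 'I_r -> rat) (i : 'I_r) :
  (height (c i) <= L)%N -> (height (c i) * #|box_slice L c| <= 2 * L ^ r)%N.
Proof.
set h := height _ => hL; have h0 : (0 < h)%N := height_gt0 _.
case: r c i @h hL h0 => [c []//|r] c i h hL h0.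
apply: leq_trans (leq_mul (leqnn h) (card_slice_height L c i)) _.
rewrite -/h /= mulnCA expnS (mulnA 2) (mulnC (2 * L)%N) leq_mul2l; apply/orP; right.
by rewrite mulnS mulnC; have := leq_trunc_div L.-1 h; lia.
Qed.

Lemma card_slice_tall r L (c : 'I_r -> rat) (i : 'I_r) :
  (L < height (c i))%N -> (#|box_slice L c| <= L ^ r.-1)%N.
Proof.
move=> hL; apply: leq_trans (card_slice_height L c i) _.
by rewrite divn_small ?muln1 //; lia.
Qed.

(** Unless the form is a coordinate, it leaves {1, ..., L} on a fixed proportion
    of the box. An entry of height at least 2 keeps about half of each line at
    most. If all entries are 0, 1 or -1, two nonzero ones are handled by
    [card_slice_pair]; with at most one nonzero entry the form is 0 or the
    opposite of a coordinate, which is never positive. The constant 8/9 is what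
    the pairing leaves for L = 3, its worst case. *)
Lemma card_slice_nonunit r L (c : 'I_r -> rat) : (2 <= L)%N ->
  (forall i, exists j, c j != (j == i)%:R) -> (9 * #|box_slice L c| <= 8 * L ^ r)%N.
Proof.
move=> L2 cN.
have [|] := boolP [exists i, (2 <= height (c i))%N].
  move=> /existsP[i hi]; have := card_slice_height L c i.
  case: r c cN i hi => [c cN []//|r] c cN i hi /= H.
  have : ((L.-1 %/ height (c i)) <= L.-1 %/ 2)%N by apply: leq_div2l.
  move=> H2; have {H H2} : (#|box_slice L c| <= L ^ r * (L.-1 %/ 2).+1)%N.
    by apply: leq_trans H _; rewrite leq_mul2l ltnS H2 orbT.
  move=> H; apply: leq_trans (leq_mul (leqnn 9) H) _.
  rewrite mulnCA [(L ^ r.+1)%N]expnS (mulnA 8) (mulnC (8 * L)%N) leq_mul2l; apply/orP; right.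
  by have := leq_trunc_div L.-1 2; lia.
move=> /existsPn small.
have cE i : [\/ c i = 0, c i = 1 | c i = -1].
  by apply: height_le1; have := small i; rewrite -leqNgt.
have nz i : c i != 0 -> c i = 1 \/ c i = -1.
  by case: (cE i) => ->; rewrite ?eqxx //; [left|right].
have [|] := boolP [exists i, [exists j, [&& i != j, c i != 0 & c j != 0]]].
  move=> /existsP[i /existsP[j /and3P[ij ci cj]]].
  have := card_slice_pair L ij (nz _ ci) (nz _ cj).
  case: r c cN small cE nz i j ij ci cj => [|[|r]] c cN small cE nz i j ij ci cj.
  - by case: i ij ci => [].
  - by move: ij; rewrite !ord1.
  have -> : (L ^ r.+2 = L * L * L ^ r)%N by rewrite !expnS mulnA.
  rewrite /=; set X := (L ^ r)%N; set S := #|_|; set Q := (_ ^ 2)%N.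
  have H1 : (L * L <= 9 * Q)%N.
    rewrite /Q -[L in (L * _)%N]odd_double_half -[L in (_ * L)%N]odd_double_half.
    have : (0 < L./2)%N by rewrite half_gt0.
    by case: (odd L); rewrite -addnn; nia.
  have := leq_mul H1 (leqnn X); rewrite -(mulnA 9).
  by set P := (_ * _ * X)%N; set QX := (Q * X)%N; lia.
move=> /existsPn one.
suff -> : box_slice L c = finset.set0 by rewrite cards0 muln0.
apply/setP => u; rewrite !inE; apply/negbTE/existsPn => w.
apply/negP => /eqP E.
have [|/existsPn z] := boolP [exists i, c i != 0].
  move=> /existsP[i ci].
  have z j : j != i -> c j = 0.
    move=> ji; have /existsPn/(_ j) := one i.
    by rewrite eq_sym ji ci /= negbK => /eqP.
  have linE : lin_form c u = c i * (u i).+1%:R.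
    rewrite /lin_form (bigD1 i) //= big1 ?addr0 // => j ji.
    by rewrite (z _ ji) mul0r.
  case: (nz _ ci) => ciE.
    have [j] := cN i; case: (eqVneq j i) => [->|ji]; first by rewrite ciE eqxx.
    by rewrite (z _ ji) eqxx.
  have : lin_form c u < 0 by rewrite linE ciE mulN1r oppr_lt0 ltr0n.
  by rewrite E ltNge ler0n.
have : lin_form c u = 0.
  by rewrite /lin_form big1 // => j _; have := z j; rewrite negbK => /eqP ->; rewrite mul0r.
by rewrite E => /eqP; rewrite pnatr_eq0.
Qed.

Definition point_mx k D L (f : {ffun 'I_k -> {ffun 'I_D -> 'I_L}}) : 'M[rat]_(k, D) :=
  \matrix_(i, j) (f i j).+1%:R.

Definition factor_set k r D L (C : 'M[rat]_(k, r)) (I : 'I_r -> 'I_k) :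
    {set {ffun 'I_k -> {ffun 'I_D -> 'I_L}}} :=
  [set f | point_mx f == C *m rowsub I (point_mx f)].

(** The matrix is read column by column: a column is determined by its entries
    in the rows I, and these entries form a point of the slice of every row of
    C. *)
Lemma card_factor_set k r D L (C : 'M[rat]_(k, r)) (I : 'I_r -> 'I_k) l :
  (#|factor_set D L C I| <= #|box_slice L (C l)| ^ D)%N.
Proof.
pose cols (f : {ffun 'I_k -> {ffun 'I_D -> 'I_L}}) :
    {ffun 'I_D -> {ffun 'I_r -> 'I_L}} := [ffun j => [ffun i => f (I i) j]].
have fE f m j : f \in factor_set D L C I -> (f m j).+1%:R = lin_form (C m) (cols f j).
  rewrite inE => /eqP/matrixP/(_ m j); rewrite !mxE => ->.
  by apply: eq_bigr => i _; rewrite !mxE !ffunE.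
have inj : {in factor_set D L C I &, injective cols}.
  move=> f g fS gS E; apply/ffunP => m; apply/ffunP => j; apply: val_inj.
  have := fE _ m j fS; rewrite E -(fE _ m j gS) => /eqP.
  by rewrite eqr_nat eqSS => /eqP.
rewrite -(card_in_image inj).
have -> : (#|box_slice L (C l)| ^ D =
    #|(ffun_on (mem (box_slice L (C l))) : simpl_pred {ffun 'I_D -> {ffun 'I_r -> 'I_L}})|)%N.
  by rewrite card_ffun_on card_ord.
apply: subset_leq_card; apply/fintype.subsetP => g /fintype.imageP[f fS ->] {g}.
apply/ffun_onP => j; rewrite inE; apply/existsP; exists (f l j).
by rewrite -fE.
Qed.

(** The coefficients of the rows of b with respect to its rows I, when the
    latter form an invertible matrix. *)
Definition coef_of k r L (I : 'I_r -> 'I_k) (b : {ffun 'I_k -> {ffun 'I_r -> 'I_L}}) :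
    'M[rat]_(k, r) := point_mx b *m invmx (rowsub I (point_mx b)).

(** In a maximal set I of independent rows choose as many independent columns.
    The minor b made of these columns determines the coefficients of all the
    rows with respect to the rows I. Some row is not in I; as the rows are
    distinct, its coefficients do not form a unit vector. *)
Lemma dependent_factor k D L (f : {ffun 'I_k -> {ffun 'I_D -> 'I_L}}) :
  injective f -> (\rank (point_mx f) < k)%N ->
  exists (I : {ffun 'I_(\rank (point_mx f)) -> 'I_k}) (b : {ffun 'I_k ->
      {ffun 'I_(\rank (point_mx f)) -> 'I_L}}),
    f \in factor_set D L (coef_of I b) I /\
    exists l, forall i, exists j, coef_of I b l j != (j == i)%:R.
Proof.
move=> f_inj rk.
set A := point_mx f; set I := maxrankfun A.
pose R := rowsub I A.
have Rfull : row_full R^T by rewrite /row_full mxrank_tr; exact: maxrowsub_free.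
pose J := fullrankfun Rfull.
pose b : {ffun 'I_k -> {ffun 'I_(\rank A) -> 'I_L}} := [ffun l => [ffun i => f l (J i)]].
have bE : point_mx b = colsub J A by apply/matrixP => i j; rewrite !mxE !ffunE.
have bU : rowsub I (point_mx b) \in unitmx.
  rewrite bE -unitmx_tr (_ : _^T = rowsub J R^T) ?fullrowsub_unit //.
  by apply/matrixP => i j; rewrite !mxE.
have [C AE] : exists C, A = C *m R by apply/submxP; rewrite (eq_maxrowsub A).
have bC : point_mx b = C *m rowsub I (point_mx b).
  apply/matrixP => i j; have /matrixP/(_ i (J j)) := AE.
  rewrite !mxE !ffunE => ->.
  by apply: eq_bigr => m _; rewrite !mxE !ffunE.
have CE : coef_of I b = C by rewrite /coef_of {1}bC mulmxK.
exists I, b; split; first by rewrite inE CE -/A -AE.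
have [l lI] : exists l, l \notin codom I.
  apply/existsP; apply: contraT => /existsPn all.
  have : (#|'I_k| <= #|codom I|)%N.
    by apply: subset_leq_card; apply/fintype.subsetP => l _; have := all l; rewrite negbK.
  rewrite card_ord leqNgt => /negP []; apply: leq_ltn_trans rk.
  by apply: leq_trans (leq_image_card _ _) _; rewrite card_ord.
exists l => i; rewrite CE; apply/existsP; apply: contraT => /existsPn all.
have {}all j : C l j = (j == i)%:R by have := all j; rewrite negbK => /eqP.
suff E : l = I i by move: lI; rewrite E codom_f.
apply: f_inj; apply/ffunP => j; apply: val_inj.
have /matrixP/(_ l j) := AE; rewrite !mxE (bigD1 i) //= all eqxx mul1r big1 ?addr0.
  by rewrite !mxE => /eqP; rewrite eqr_nat eqSS => /eqP.
by move=> m /negbTE mi; rewrite all mi mul0r.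
Qed.

Definition dependent_tuples (k D L r : nat) : {set {ffun 'I_k -> {ffun 'I_D -> 'I_L}}} :=
  [set f : {ffun 'I_k -> {ffun 'I_D -> 'I_L}} | injectiveb f && (\rank (point_mx f) == r)].

Lemma leq_card_cover (T X : finType) (S : X -> {set T}) (A : {set T}) :
  {in A, forall f, exists x, f \in S x} -> (#|A| <= \sum_x #|S x|)%N.
Proof.
move=> cov; under eq_bigr do rewrite -sum1_card big_mkcond /=.
rewrite exchange_big /= -sum1_card big_mkcond /=; apply: leq_sum => f _.
case: ifP => // /cov[x fx]; by rewrite (bigD1 x) //= fx.
Qed.

(** Numerators are shifted by h, so that the codes form a finite type and reach
    all the matrices with entries of height at most h. *)
Definition matrix_of_code k r h (e : {ffun 'I_k * 'I_r ->
    'I_(2 * h).+1 * 'I_h.+1}) : 'M[rat]_(k, r) :=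
  \matrix_(l, j) (((e (l, j)).1%:Z - h%:Z)%:~R / (e (l, j)).2%:R).

Lemma matrix_of_codeP k r h (C : 'M[rat]_(k, r)) :
  (forall l j, height (C l j) <= h)%N -> exists e, matrix_of_code (h := h) e = C.
Proof.
move=> Ch.
exists [ffun x => (inord (absz (numq (C x.1 x.2) + h%:Z)), inord (absz (denq (C x.1 x.2))))].
apply/matrixP => l j; rewrite mxE !ffunE /=.
have := Ch l j; rewrite geq_max => /andP[nh dh].
rewrite !inordK; [|lia|lia].
rewrite -[RHS]divq_num_den; congr (_%:~R / _); first by lia.
by rewrite pmulrn gez0_abs.
Qed.

Section Count.
Variables (k D L r : nat).
Hypotheses (L2 : (2 <= L)%N).

Let has_new_row (C : 'M[rat]_(k, r)) : bool :=
  [exists l, forall i, [exists j, C l j != (j == i)%:R]].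

(** The tuples are sorted according to the largest height h of an entry of their
    coefficient matrix. For h <= L these matrices are enumerated by their codes;
    above L there would be too many codes, but the slices are then so thin that
    an enumeration by the minors is sufficient. *)
Let flat_tuples h (x : {ffun 'I_r -> 'I_k} * {ffun 'I_k * 'I_r -> 'I_(2 * h).+1 * 'I_h.+1}) :=
  if [&& has_new_row (matrix_of_code x.2), (h <=
      L)%N & (h == 1)%N || [exists l, exists j, height (matrix_of_code x.2 l j) == h]]
  then factor_set D L (matrix_of_code x.2) x.1 else finset.set0.

Let tall_tuples (x : {ffun 'I_r -> 'I_k} * {ffun 'I_k -> {ffun 'I_r -> 'I_L}}) :=
  if [exists l, exists j, (L < height (coef_of x.1 x.2 l j))%N]
  then factor_set D L (coef_of x.1 x.2) x.1 else finset.set0.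

Lemma card_dependent_split : (r < k)%N ->
  (#|dependent_tuples k D L r| <=
   \sum_(h : 'I_L) (\sum_x #|flat_tuples (h := h.+1) x|) + \sum_x #|tall_tuples x|)%N.
Proof.
move=> rk.
pose A1 (h : 'I_L) := \bigcup_x flat_tuples (h := h.+1) x.
pose A2 := \bigcup_x tall_tuples x.
have sub : dependent_tuples k D L r \subset (\bigcup_h A1 h) :|: A2.
  apply/fintype.subsetP => f; rewrite inE => /andP[/injectiveP f_inj /eqP fr].
  have [] := dependent_factor f_inj; first by rewrite fr.
  rewrite fr => I [b [fI [l lN]]].
  have nu : has_new_row (coef_of I b).
    by apply/existsP; exists l; apply/forallP => i; apply/existsP; exact: lN.
  rewrite inE; case: (boolP [exists l, exists j, (L < height (coef_of I b l j))%N]) => [ht|].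
    apply/orP; right; apply/bigcupP; exists (I, b) => //.
    by rewrite /tall_tuples /= ht.
  move=> /existsPn ht; apply/orP; left.
  have {}ht m j : (height (coef_of I b m j) <= L)%N.
    by have /existsPn/(_ j) := ht m; rewrite -leqNgt.
  have [h [h1 hL hC hex]] : exists h, [/\ (0 < h)%N, (h <= L)%N,
      forall m j, (height (coef_of I b m j) <= h)%N &
      (h == 1)%N || [exists m, exists j, height (coef_of I b m j) == h]].
    have [e|] := posnP #|{: 'I_k * 'I_r}|.
      exists 1%N; split => //; first by lia.
      by move=> m j; have := card0_eq e (m, j).
    move=> /(bigop.eq_bigmax (fun x => height (coef_of I b x.1 x.2)))[[m j] /= E].
    exists (height (coef_of I b m j)); split => //.
    - exact: height_gt0.
    - move=> m' j'; rewrite -E.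
      exact: (bigop.leq_bigmax (F := fun x => height (coef_of I b x.1 x.2)) (m', j')).
    - by apply/orP; right; apply/existsP; exists m; apply/existsP; exists j.
  case: h h1 hL hC hex => // h _ hL hC hex.
  apply/bigcupP; exists (Ordinal hL) => //.
  have [e eE] := matrix_of_codeP hC.
  by apply/bigcupP; exists (I, e) => //; rewrite /flat_tuples /= eE nu hL hex.
apply: leq_trans (subset_leq_card sub) _.
apply: leq_trans (leq_card_setU _ _) _; apply: leq_add.
  apply: leq_trans (leq_card_cover (S := A1) _) _.
    by move=> f /bigcupP[h _ fh]; exists h.
  apply: leq_sum => h _; apply: leq_card_cover.
  by move=> f /bigcupP[x _ fx]; exists x.
by apply: leq_card_cover => f /bigcupP[x _ fx]; exists x.
Qed.

Lemma card_tall x : (#|tall_tuples x| * L ^ D <= L ^ (r * D))%N.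
Proof.
rewrite /tall_tuples; case: ifP => [/existsP[l /existsP[j lj]]|_]; last by rewrite cards0.
apply: leq_trans (leq_mul (card_factor_set _ _ _ _ l) (leqnn _)) _.
rewrite -expnMn expnM; case: D => [|D']; first by rewrite !expn0.
rewrite leq_exp2r //; apply: leq_trans (leq_mul (card_slice_tall lj) (leqnn _)) _.
by rewrite -expnSr prednK // (leq_trans _ (ltn_ord j)).
Qed.

Variable (R : realFieldType).

(** Two bounds on the slices are mixed: for D - D0 columns the proportion 8/9,
    which gives the decay in D, and for D0 columns the proportion 2 / h, which
    pays for the number of codes of height h. *)
Lemma card_flat h x D0 : (0 < h)%N -> (D0 <= D)%N -> (#|flat_tuples (h := h) x|%:R : R) <=
  (L ^ (r * D))%:R * ((8 / 9) ^+ (D - D0) * (2 / h%:R) ^+ D0).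
Proof.
move=> h0 D0D.
have h0' : 0 < h%:R :> R by rewrite ltr0n.
rewrite /flat_tuples; case: ifP => [/and3P[nu hL hh]|_]; last first.
  by rewrite cards0 !mulr_ge0 ?exprn_ge0 // divr_ge0.
set C := matrix_of_code _ in nu hh *.
set F := #|_|; set M : R := (L ^ r)%:R.
have M0 : 0 < M by rewrite ltr0n expn_gt0 (leq_trans _ L2).
have [s sF s1] : exists2 s : nat, (F <= s ^ D)%N & s%:R <= (8 / 9) * M.
  move/existsP : nu => [l /forallP lN]; exists #|box_slice L (C l)|;
      first exact: card_factor_set.
  have : (9 * #|box_slice L (C l)| <= 8 * L ^ r)%N.
    by apply: card_slice_nonunit => // i; apply/existsP; exact: lN.
  by rewrite -(ler_nat R) !natrM -/M; lra.
have [t tF t1] : exists2 t : nat, (F <= t ^ D)%N & t%:R <= (2 / h%:R) * M.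
  have [h1|hN1] := eqVneq h 1%N.
    move/existsP : nu => [l /forallP lN]; exists #|box_slice L (C l)|;
        first exact: card_factor_set.
    have := max_card (box_slice L (C l)); rewrite card_ffun !card_ord -(ler_nat R) -/M h1.
    by lra.
  move: hh; rewrite (negbTE hN1) /= => /existsP[l /existsP[j /eqP lj]].
  exists #|box_slice L (C l)|; first exact: card_factor_set.
  have := card_slice_le (L := L) (c := C l) (i := j); rewrite lj => /(_ hL).
  rewrite -(ler_nat R) !natrM -/M => H.
  by rewrite mulrAC ler_pdivlMr // mulrC.
have -> : (L ^ (r * D))%:R = M ^+ (D - D0) * M ^+ D0 :> R.
  by rewrite -exprD subnK // expnM natrX.
rewrite mulrACA -!exprMn.
pose y := minn s t.
have Fy : (F <= y ^ D)%N by rewrite /y; case: (leqP s t).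
have ys : y%:R <= s%:R :> R by rewrite ler_nat geq_minl.
have yt : y%:R <= t%:R :> R by rewrite ler_nat geq_minr.
apply: (@le_trans _ _ (y%:R ^+ (D - D0) * y%:R ^+ D0)).
  by rewrite -exprD subnK // -natrX ler_nat.
apply: ler_pM; rewrite ?exprn_ge0 //.
  by apply: lerXn2r; rewrite ?nnegrE ?mulr_ge0 // ?(ltW M0) // ?divr_ge0 //; lra.
by apply: lerXn2r; rewrite ?nnegrE ?mulr_ge0 // ?(ltW M0) // ?divr_ge0 //; lra.
Qed.
End Count.

Lemma sum_inv_sq (R : realFieldType) L : \sum_(h < L) (h.+1%:R ^- 2) <= 2 :> R.
Proof.
case: L => [|L]; first by rewrite big_ord0.
suff : \sum_(h < L.+1) (h.+1%:R ^- 2) <= 2 - L.+1%:R^-1 :> R.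
  by move=> H; apply: le_trans H _; rewrite gerBl invr_ge0.
elim: L => [|L IH]; first by rewrite big_ord_recl big_ord0 /= expr1n !invr1; lra.
rewrite big_ord_recr /=; apply: (le_trans (lerD IH (lexx _))).
have a0 : 0 < L.+1%:R :> R by rewrite ltr0n.
have -> : L.+2%:R = L.+1%:R + 1 :> R by rewrite natr1.
move: L.+1%:R a0 => a a0.
rewrite -subr_ge0.
rewrite [X in 0 <= X](_ : _ = (a * (a + 1) ^+ 2)^-1); last first.
  by field; lra.
by rewrite invr_ge0 mulr_ge0 ?exprn_ge0 //; lra.
Qed.

(** There are at most (6 h^2)^(k^2) codes of height h. The exponent 2 k^2 + 2
    given to 2 / h turns the sum over h into a convergent one. When L and then D
    tend to infinity, the last factor of the bound tends to 0. *)
Lemma card_dependent (R : realFieldType) k D L r : (r < k)%N -> (2 <= L)%N ->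
  (2 * (k * k) + 2 <= D)%N ->
  #|dependent_tuples k D L r|%:R <= (L ^ (r * D))%:R * (k ^ k)%:R *
   (6 ^+ (k * k) * 2 ^+ (2 * (k * k) + 2) * 2 * (8 / 9) ^+ (D - (2 * (k * k) + 2)) +
    L%:R ^+ (k * k) / L%:R ^+ D) :> R.
Proof.
move=> rk L2; set p := (k * k)%N; set D0 := (2 * p + 2)%N => D0D.
have L0 : (0 < L)%N by apply: leq_trans L2.
have k0 : (0 < k)%N by apply: leq_ltn_trans rk.
have := card_dependent_split D L2 rk; rewrite -(ler_nat R) natrD => H; apply: (le_trans H).
have cardT' (A B : finType) : #|(xpredT : pred (A * B)%type)| = (#|A| * #|B|)%N.
  by rewrite -card_prod; apply: eq_card.
have cardI : (#|{ffun 'I_r -> 'I_k}| <= k ^ k)%N.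
  by rewrite card_ffun !card_ord leq_pexp2l // ltnW.
rewrite mulrDr; apply: lerD.
- rewrite natr_sum; apply: (@le_trans _ _ (\sum_(h < L) (L ^ (r * D))%:R * (k ^ k)%:R *
    6 ^+ p * 2 ^+ D0 * (8 / 9) ^+ (D - D0) * h.+1%:R ^- 2)).
    apply: ler_sum => h _; rewrite natr_sum.
    apply: le_trans; first by apply: ler_sum => x _; exact: (card_flat L2 R x (ltn0Sn h) D0D).
    rewrite sumr_const -[_ *+ #|_|]mulr_natr cardT' natrM.
    set a : R := (L ^ _)%:R; set b : R := _ ^+ (D - D0).
    have a0 : 0 <= a by rewrite ler0n.
    have b0 : 0 <= b by rewrite exprn_ge0.
    have h0 : 0 < h.+1%:R :> R by rewrite ltr0n.
    have -> : a * (b * (2 / h.+1%:R) ^+ D0) * (#|{ffun 'I_r -> 'I_k}|%:R *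
      #|{ffun 'I_k * 'I_r -> 'I_(2 * h.+1).+1 * 'I_h.+2}|%:R) =
      (a * b * 2 ^+ D0) * (#|{ffun 'I_r -> 'I_k}|%:R *
       (#|{ffun 'I_k * 'I_r -> 'I_(2 * h.+1).+1 * 'I_h.+2}|%:R * h.+1%:R ^- D0)).
      by rewrite expr_div_n; ring.
    have -> : a * (k ^ k)%:R * 6 ^+ p * 2 ^+ D0 * b * h.+1%:R ^- 2 =
      (a * b * 2 ^+ D0) * ((k ^ k)%:R * (6 ^+ p * h.+1%:R ^- 2)) by ring.
    apply: ler_wpM2l; first by rewrite !mulr_ge0 ?exprn_ge0.
    apply: ler_pM => //; rewrite ?mulr_ge0 ?invr_ge0 ?exprn_ge0 ?ler_nat //.
    have e : (#|{ffun 'I_k * 'I_r -> 'I_(2 * h.+1).+1 * 'I_h.+2}| <= (6 * h.+1 ^ 2) ^ p)%N.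
      rewrite card_ffun !card_prod !card_ord.
      apply: (@leq_trans ((6 * h.+1 ^ 2) ^ (k * r))).
        case: (k * r)%N => // q; rewrite leq_exp2r //.
        by rewrite -mulnn; nia.
      by rewrite leq_pexp2l // ?leq_mul2l ?(ltnW rk) ?orbT // muln_gt0 expn_gt0.
    rewrite ler_pdivrMr ?exprn_gt0 //.
    rewrite [X in _ <= X](_ : _ = (6 * h.+1%:R ^+ 2) ^+ p); last first.
      have -> : h.+1%:R ^+ D0 = h.+1%:R ^+ 2 * (h.+1%:R ^+ 2) ^+ p :> R.
        by rewrite -exprM -exprD /D0 addnC.
      by rewrite exprMn mulrA divfK // !exprMn.
    by move: e; rewrite -(ler_nat R) natrX natrM natrX.
  rewrite -mulr_sumr.
  have := sum_inv_sq R L; set S := \sum_(_ < _) _ => S2.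
  rewrite [X in _ <= X](_ : _ = (L ^ (r * D))%:R * (k ^ k)%:R * 6 ^+ p * 2 ^+ D0 *
      (8 / 9) ^+ (D - D0) * 2); last by ring.
  by apply: ler_wpM2l => //; rewrite !mulr_ge0 ?exprn_ge0.
- have LD0 : 0 < L%:R ^+ D :> R by rewrite exprn_gt0 // ltr0n.
  rewrite natr_sum; apply: (@le_trans _ _ (\sum_(x : {ffun 'I_r -> 'I_k} * {ffun 'I_k ->
      {ffun 'I_r -> 'I_L}}) (L ^ (r * D))%:R / L%:R ^+ D)).
    apply: ler_sum => x _; rewrite ler_pdivlMr // -natrX -natrM ler_nat.
    exact: card_tall.
  rewrite sumr_const -[_ *+ #|_|]mulr_natr cardT' natrM.
  rewrite [X in X <= _](_ : _ = (L ^ (r * D))%:R / L%:R ^+ D * (#|{ffun 'I_r ->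
      'I_k}|%:R * #|{ffun 'I_k -> {ffun 'I_r -> 'I_L}}|%:R)) //.
  rewrite [X in _ <= X](_ : _ = (L ^ (r * D))%:R / L%:R ^+ D * ((k ^ k)%:R * L%:R ^+ p));
      last by ring.
  apply: ler_wpM2l; first by rewrite divr_ge0 // ltW.
  apply: ler_pM => //; rewrite ?ler_nat // -natrX ler_nat.
  by rewrite !card_ffun !card_ord -expnM leq_pexp2l // leq_mul2r (ltnW rk) orbT.
Qed.

(** * Bonferroni inequalities *)

Section Bonferroni.
Variable R : realFieldType.

(** Its coefficients are the elementary symmetric functions of s. *)
Definition gen_poly (s : seq R) : {poly R} := \prod_(y <- s) (1 + y *: 'X).

Lemma gen_poly_cons0 y s : (gen_poly (y :: s))`_0 = (gen_poly s)`_0.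
Proof. by rewrite /gen_poly big_cons mulrDl mul1r coefD -scalerAl coefZ coefXM mulr0 addr0. Qed.

Lemma gen_poly_consS y s k :
  (gen_poly (y :: s))`_k.+1 = (gen_poly s)`_k.+1 + y * (gen_poly s)`_k.
Proof. by rewrite /gen_poly big_cons mulrDl mul1r coefD -scalerAl coefZ coefXM. Qed.

(** When a factor is added, the signed error terms obey the recursion of the
    elementary symmetric functions, so both bounds follow by induction on s. *)
Lemma bonferroni_seq (s : seq R) K : all (fun y => 0 <= y <= 1) s ->
  0 <= (-1) ^+ K * (\prod_(y <- s) (1 - y) - \sum_(k < K) (-1) ^+ k * (gen_poly s)`_k)
    <= (gen_poly s)`_K.
Proof.
elim: s K => [|y s IH] K.
  move=> _; rewrite /gen_poly !big_nil.
  case: K => [|K]; first by rewrite big_ord0 expr0 mul1r subr0 coef1 /= ler01 lexx.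
  rewrite big_ord_recl big1 => [|i _]; last by rewrite coef1 /= mulr0.
  by rewrite !coef1 /= expr0 mul1r addr0 subrr mulr0 lexx.
move=> /= /andP[/andP[y0 y1] sP]; rewrite big_cons; case: K => [|K].
  have /andP := IH 0%N sP; rewrite !big_ord0 !expr0 !mul1r !subr0 gen_poly_cons0 => -[H1 H2].
  by apply/andP; split; nra.
have /andP[H1 H2] := IH K.+1 sP; have /andP[H3 H4] := IH K sP.
have alt (f : nat -> R) : \sum_(i < K.+1) (-1) ^+ i * f i =
    f 0%N - \sum_(i < K) (-1) ^+ i * f i.+1.
  rewrite big_ord_recl expr0 mul1r -sumrN; congr (_ + _).
  by apply: eq_bigr => i _; rewrite lift0 exprS; ring.
rewrite (alt (fun i => (gen_poly (y :: s))`_i)) gen_poly_cons0 gen_poly_consS.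
rewrite (alt (fun i => (gen_poly s)`_i)) in H1 H2.
rewrite [X in _ - (_ - X)](_ : _ = \sum_(i < K) (-1) ^+ i * (gen_poly s)`_i.+1 +
    y * \sum_(i < K) (-1) ^+ i * (gen_poly s)`_i); last first.
  rewrite mulr_sumr -big_split /=; apply: eq_bigr => i _.
  by rewrite gen_poly_consS; ring.
move: H1 H2 H3 H4.
set S := \sum_(i < K) (-1) ^+ i * _`_i.+1; set S' := \sum_(i < K) (-1) ^+ i * _`_i.
set P := \prod_(_ <- _) _; set e0 := _`_0; set e1 := _`_K.+1; set e2 := _`_K.
rewrite exprS; set u := (-1) ^+ K => H1 H2 H3 H4.
have -> : -1 * u * ((1 - y) * P - (e0 - (S + y * S'))) =
  -1 * u * (P - (e0 - S)) + y * (u * (P - S')) by ring.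
apply/andP; split; first by apply: addr_ge0 => //; exact: mulr_ge0.
by apply: lerD => //; apply: ler_wpM2l.
Qed.

Variable (T : finType) (x : T -> R).

Definition elem_sym k : R := \sum_(A : {set T} | #|A| == k) \prod_(m in A) x m.

Lemma gen_poly_elem_sym k : (gen_poly [seq x m | m <- enum T])`_k = elem_sym k.
Proof.
rewrite /gen_poly big_map big_enum /=.
rewrite (eq_bigr (fun m => x m *: 'X + 1)); last by move=> m _; rewrite addrC.
rewrite bigA_distr /= coef_sum [RHS]big_mkcond /=; apply: eq_bigr => A _.
rewrite -big_mkcond /= (_ : \prod_(i in A) (x i *: 'X) = (\prod_(m in A) x m) *: 'X^#|A|);
    last first.
  by rewrite scaler_prod prodr_const.
by rewrite coefZ coefXn eq_sym; case: eqP; rewrite ?mulr1 ?mulr0.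
Qed.

Lemma bonferroni K : (forall m, 0 <= x m <= 1) ->
  `|\prod_m (1 - x m) - \sum_(k < K) (-1) ^+ k * elem_sym k| <= elem_sym K.
Proof.
move=> x01; have := @bonferroni_seq [seq x m | m <- enum T] K.
rewrite all_map (_ : all _ _); last by apply/allP => m _ /=; exact: x01.
move=> /(_ isT); rewrite gen_poly_elem_sym big_map big_enum /=.
under [X in _ - X]eq_bigr do rewrite gen_poly_elem_sym.
set d := _ - _ => /andP[h1 h2]; apply: le_trans h2.
by rewrite -(ger0_norm h1) normrMsign.
Qed.
End Bonferroni.

Lemma bernoulli_ineq (R : realFieldType) (x : R) k : 0 <= x <= 1 ->
    1 - k%:R * x <= (1 - x) ^+ k.
Proof.
move=> /andP[x0 x1]; elim: k => [|k IH]; first by rewrite mul0r subr0 expr0.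
rewrite exprS; have x1' : 0 <= 1 - x by lra.
have := ler_wpM2l x1' IH => H; apply: le_trans H.
rewrite -natr1; have : 0 <= k%:R :> R by []. 
by move: k%:R => n n0; nra.
Qed.

(** Both L^D / N and the falling factorial divided by the power are close to 1,
    with errors controlled by Bernoulli's inequality. *)
Lemma bin_approx (R : realFieldType) (D L N k : nat) :
  (0 < D)%N -> (0 < L)%N -> (k <= L)%N -> (L ^ D <= N < L.+1 ^ D)%N ->
  `|('C(L ^ D, k))%:R / N%:R ^+ k - (k`!)%:R^-1| <= (k * (D + k))%:R / L%:R :> R.
Proof.
move=> D0 L0 kL /andP[nN Nn].
set n := (L ^ D)%N in nN *.
have Ln : (L <= n)%N by rewrite /n -{1}(expn1 L) leq_pexp2l.
have N0 : 0 < N%:R :> R by rewrite ltr0n (leq_trans L0) // (leq_trans Ln).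
have f0 : 0 < (k`!)%:R :> R by rewrite ltr0n fact_gt0.
have f1 : (k`!)%:R^-1 <= 1 :> R by rewrite invf_le1 // ler1n fact_gt0.
have kn : (k <= n)%N by apply: leq_trans kL Ln.
have L0' : 0 < L%:R :> R by rewrite ltr0n.
have bE : ('C(n, k))%:R = (n ^_ k)%:R / (k`!)%:R :> R.
  by rewrite -bin_ffact natrM mulfK // gt_eqF.
have up : (n ^_ k <= N ^ k)%N.
  rewrite ffact_prod -[X in (_ <= _ ^ X)%N]card_ord -prod_nat_const; apply: leq_prod => i _.
  by apply: leq_trans nN; rewrite leq_subr.
have lo : ((n - k) ^ k <= n ^_ k)%N.
  rewrite ffact_prod -[X in (_ ^ X <= _)%N]card_ord -prod_nat_const; apply: leq_prod => i _.
  by rewrite leq_sub2l // ltnW.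
set q : R := (n ^_ k)%:R / N%:R ^+ k.
have q1 : q <= 1 by rewrite ler_pdivrMr ?exprn_gt0 // mul1r -natrX ler_nat.
have q0 : 1 - (k * (D + k))%:R / L%:R <= q.
  set y : R := 1 - (n - k)%:R / N%:R.
  have nk1 : (n - k)%:R / N%:R <= 1 :> R by rewrite ler_pdivrMr // mul1r ler_nat (leq_trans
      (leq_subr _ _)).
  have y01 : 0 <= y <= 1 by rewrite /y subr_ge0 nk1 gerBl divr_ge0.
  have := bernoulli_ineq k y01; rewrite {2}/y subKr expr_div_n => H.
  apply: (@le_trans _ _ ((n - k)%:R ^+ k / N%:R ^+ k)); last first.
    by rewrite ler_pM2r ?invr_gt0 ?exprn_gt0 // -natrX ler_nat.
  apply: le_trans H; rewrite lerD2l lerN2 natrM -mulrA ler_wpM2l //.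
  have nN1 : 1 - D%:R / L%:R <= n%:R / N%:R :> R.
    have L10 : 0 < L.+1%:R :> R by rewrite ltr0n.
    apply: (@le_trans _ _ ((1 - L.+1%:R^-1) ^+ D)).
      apply: le_trans (bernoulli_ineq D _); last first.
        by rewrite invr_ge0 ltW //= invf_le1 // ler1n.
      by rewrite lerD2l lerN2 ler_wpM2l // lef_pV2 ?posrE // ler_nat.
    have -> : 1 - L.+1%:R^-1 = L%:R / L.+1%:R :> R.
      by rewrite -natr1; field; rewrite natr1 gt_eqF.
    rewrite expr_div_n -!natrX -/n ler_wpM2l // lef_pV2 ?posrE ?ltr0n ?expn_gt0 //.
      by rewrite ler_nat ltnW.
    by move: N0; rewrite ltr0n.
  have kN : k%:R / N%:R <= k%:R / L%:R :> R.
    by rewrite ler_wpM2l // lef_pV2 ?posrE // ler_nat (leq_trans Ln).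
  by rewrite /y natrB // natrD mulrBl mulrDl; lra.
rewrite bE -/q mulrAC -/q.
have -> : q / (k`!)%:R - (k`!)%:R^-1 = - ((1 - q) / (k`!)%:R) by ring.
rewrite normrN ger0_norm; last by apply: divr_ge0; [rewrite subr_ge0|exact: ltW].
apply: (@le_trans _ _ (1 - q)); last by lra.
by rewrite ler_piMr // subr_ge0.
Qed.

Local Open Scope classical_set_scope.
Local Open Scope ring_scope.

(** * Translation invariance on the torus *)

Section Translation.
Context {R : realType}.
Notation mu := (@lebesgue_measure R).
Notation RT := (measurableTypeR R).

Lemma measurable_shift (v : R) : measurable_fun [set: RT] (fun x : RT => x + v : RT).
Proof. by apply: measurable_funD => //; exact: measurable_cst. Qed.

Let shift_mfun (v : R) : {mfun RT >-> RT} := mfun_Sub (mem_set (measurable_shift v)).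

Lemma lebesgue_measure_shift (v : R) (A : set R) : measurable (A : set RT) ->
  pushforward mu (fun x : RT => x + v : RT) A = mu A.
Proof.
move=> mA; apply/esym.
apply: (@lebesgue_measure_unique _ (pushforward mu (shift_mfun v))) => // X.
case=> -[a b] _ <-; rewrite /pushforward /=.
rewrite [X in _ = lebesgue_measure X](_ : _ = `](a - v), (b - v)]%classic); last first.
  apply/seteqP; split=> x /=; rewrite !in_itv /= => /andP[h1 h2]; apply/andP; split; lra.
rewrite !lebesgue_measure_itv /= !lte_fin.
have -> : (a - v < b - v) = (a < b) by rewrite ltrD2r.
by case: ifP => // _; rewrite -!EFinD; congr (_%:E); ring.
Qed.
End Translation.

Section Periodic.
Context {R : realType}.
Notation mu := (@lebesgue_measure R).
Notation RT := (measurableTypeR R).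
Local Open Scope ereal_scope.

Lemma integral_shift (v : R) (D : set R) (f : R -> \bar R) : measurable (D : set RT) ->
  measurable_fun [set: RT] f -> (forall x, 0 <= f x) ->
  \int[mu]_(x in (fun x : R => x + v)%R @^-1` D) f (x + v)%R = \int[mu]_(x in D) f x.
Proof.
move=> mD mf f0.
rewrite -(@ge0_integral_pushforward _ _ RT RT R _ (measurable_shift v) mu D f) //.
- apply: eq_measure_integral => [|mS A mA _]; first exact: measurable_shift.
  exact: lebesgue_measure_shift.
- exact: measurable_funTS.
Qed.

Lemma integral_01_co (f : R -> \bar R) : measurable_fun [set: RT] f -> (forall x, 0 <= f x) ->
  \int[uniform_prob (@ltr01 R)]_x f x = \int[mu]_(x in `[0%R, 1%R[) f x.
Proof.
move=> mf f0; rewrite integral_uniform // subr0 invr1 mul1e.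
by rewrite -integral_itv_bndo_bndc //; exact: measurable_funTS.
Qed.

(** Only the fractional part w of the shift matters. The integral over [w, 1 +
    w) is cut at 1, and the second piece is moved back to [0, w) by periodicity. *)
Lemma integral_periodic_shift (v : R) (f : R -> \bar R) :
  measurable_fun [set: RT] f -> (forall x, 0 <= f x) ->
  (forall x (m : int), f (x + m%:~R)%R = f x) ->
  \int[uniform_prob (@ltr01 R)]_x f (x + v)%R = \int[uniform_prob (@ltr01 R)]_x f x.
Proof.
move=> mf f0 fp; rewrite !integral_01_co //; last first.
  by apply: measurableT_comp => //; exact: measurable_shift.
pose w := (v - (Num.floor v)%:~R)%R.
have /andP[w0 w1] : (0 <= w < 1)%R.
  by rewrite /w subr_ge0 ltrBlDl floor_le_tmp /= -intrD1 floorD1_gt.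
under eq_integral do rewrite -(fp _ (- Num.floor v)%R) -addrA rmorphN -/w.
have mco a b : measurable (`[a, b[%classic : set RT) by [].
have cosplit (a b c : R) : (a <= b)%R -> (b <= c)%R ->
    \int[mu]_(x in `[a, c[) f x = \int[mu]_(x in `[a, b[) f x + \int[mu]_(x in `[b, c[) f x.
  move=> ab bc.
  have -> : `[a, c[%classic = `[a, b[%classic `|` `[b, c[%classic.
    by rewrite -itv_bndbnd_setU ?bnd_simp.
  rewrite ge0_integral_setU //; first exact: measurable_funTS.
  rewrite disj_set2E; apply/eqP; apply/seteqP; split=> // x /= [].
  by rewrite !in_itv /= => /andP[_ xb] /andP[bx _]; move: (lt_le_trans xb bx); rewrite ltxx.
have shiftE (a b u : R) : \int[mu]_(x in `[a, b[) f (x + u)%R =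
    \int[mu]_(x in `[(a + u)%R, (b + u)%R[) f x.
  rewrite -(@integral_shift u `[(a + u)%R, (b + u)%R[%classic f) // (_ : _ @^-1` _ =
      `[a, b[%classic) //.
  by apply/seteqP; split=> x /=; rewrite !in_itv /= lerD2r ltrD2r.
rewrite shiftE add0r (@cosplit w 1%R) ?(ltW w1) //; last by lra.
rewrite (@cosplit 0%R w) ?(ltW w1) // addeC; congr (_ + _).
have := shiftE 0%R w 1%R; rewrite add0r (addrC w) => <-.
by apply: eq_integral => x _; rewrite -[1%R](mulr1z 1) fp.
Qed.
End Periodic.

Section TupleProb.
Context {R : realType} {disp : measure_display} {T : measurableType disp}.
Local Open Scope ereal_scope.

Lemma integral_tuple_probS n (P : 'I_n.+1 -> probability T R) (f : n.+1.-tuple T -> \bar R) :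
  measurable_fun setT f -> (forall t, 0 <= f t) ->
  \int[tuple_prob P]_t f t =
  \int[P ord0]_x \int[tuple_prob (fun i => P (lift ord0 i))]_t f (cons_pair (x, t)).
Proof.
move=> mf f0 /=.
rewrite ge0_integral_distribution // fubini_tonelli1 //.
  by apply: measurableT_comp => //; exact: measurable_cons_pair.
by move=> x; exact: f0.
Qed.

Lemma measurable_integral_tuple_probS n (P : 'I_n -> probability T R) (f : n.+1.-tuple T ->
    \bar R) :
  measurable_fun setT f -> (forall t, 0 <= f t) ->
  measurable_fun setT (fun x => \int[tuple_prob P]_t f (cons_pair (x, t))).
Proof.
move=> mf f0; apply: (@measurable_fun_fubini_tonelli_F _ _ _ _ R (tuple_prob P) (fun z =>
    f (cons_pair z))) => //.
by apply: measurableT_comp => //; exact: measurable_cons_pair.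
Qed.
End TupleProb.

Section CubeShift.
Context {R : realType}.
Notation RT := (measurableTypeR R).
Local Open Scope ereal_scope.

Definition tshift D (a : D.-tuple R) (v : 'I_D -> R) : D.-tuple R :=
  [tuple (tnth a i + v i)%R | i < D].

Lemma measurable_tshift D (v : 'I_D -> R) :
  measurable_fun setT (fun a : D.-tuple RT => tshift a v : D.-tuple RT).
Proof.
apply/measurable_fun_tnthP => i.
rewrite (_ : _ \o _ = (fun a : D.-tuple RT => tnth a i + v i : RT)%R); last first.
  by apply/funext => a /=; rewrite tnth_mktuple.
apply: measurable_funD; last exact: measurable_cst.
exact: measurable_tnth.
Qed.

Lemma tshift_cons D (x : R) (t : D.-tuple R) (v : 'I_D.+1 -> R) :
  tshift (cons_pair ((x : RT), (t : D.-tuple RT))) v =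
  cons_pair ((x + v ord0)%R : RT, tshift t (fun i => v (lift ord0 i)) : D.-tuple RT).
Proof.
apply: eq_from_tnth => i; rewrite tnth_mktuple.
by case: (unliftP ord0 i) => [j ->|->]; rewrite ?tnth0 // !tnthS tnth_mktuple.
Qed.

(** Induction on D: the integral over the last coordinates is invariant for each
    value of the first one, and is a periodic function of it. *)
Lemma integral_cube_shift D (f : D.-tuple RT -> \bar R) (v : 'I_D -> R) :
  measurable_fun setT f -> (forall a, 0 <= f a) ->
  (forall a (m : 'I_D -> int), f (tshift a (fun i => (m i)%:~R)) = f a) ->
  \int[lebesgue_cube R D]_a f (tshift a v) = \int[lebesgue_cube R D]_a f a.
Proof.
elim: D f v => [|D IH] f v mf f0 fp.
  by apply: eq_integral => a _; rewrite (tuple0 (tshift _ _)) (tuple0 a).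
have mfv : measurable_fun setT (fun a => f (tshift a v)).
  by apply: measurableT_comp => //; exact: measurable_tshift.
rewrite /lebesgue_cube !integral_tuple_probS //.
rewrite -/(lebesgue_cube R D).
pose psi (x : R) := \int[lebesgue_cube R D]_t f (cons_pair (x : RT, t)).
transitivity (\int[uniform_prob (@ltr01 R)]_x psi (x + v ord0)%R).
  apply: eq_integral => x _; rewrite /psi.
  under eq_integral do rewrite tshift_cons.
  apply: (IH (fun t => f (cons_pair ((x + v ord0)%R : RT, t)))) => //.
    apply: measurableT_comp => //; apply: measurable_cons => //=; exact: measurable_id.
  move=> a m; rewrite -[RHS](fp _ (fun i => if unlift ord0 i is Some j then m j else 0%Z)).
  rewrite tshift_cons unlift_none addr0; congr (f (cons_pair (_, _))).
  by apply: eq_from_tnth => i; rewrite !tnth_mktuple liftK.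
rewrite integral_periodic_shift // /psi.
- exact: measurable_integral_tuple_probS.
- by move=> x; apply: integral_ge0.
- move=> x m; apply: eq_integral => t _.
  rewrite -[RHS](fp _ (fun i => if unlift ord0 i is Some j then 0%Z else m)).
  rewrite tshift_cons unlift_none; congr (f (cons_pair (_, _))).
  by apply: eq_from_tnth => i; rewrite !tnth_mktuple liftK addr0.
Qed.
End CubeShift.

(** * Independence of integral linear forms *)

Lemma integral_prob_cst (R : realType) d (T : measurableType d) (P : probability T R) (x : \bar
    R) :
  (\int[P]_t x = x)%E.
Proof. by rewrite integral_cst //= probability_setT mule1. Qed.

Section Independence.
Context {R : realType}.
Notation RT := (measurableTypeR R).
Local Open Scope ereal_scope.

Definition lin_value D (c : 'I_D -> int) (a : D.-tuple R) : R :=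
  (\sum_j (c j)%:~R * tnth a j)%R.

Lemma lin_value_tshift D (c : 'I_D -> int) (a : D.-tuple R) (v : 'I_D -> R) :
  lin_value c (tshift a v) = (lin_value c a + \sum_j (c j)%:~R * v j)%R.
Proof.
by rewrite /lin_value -big_split; apply: eq_bigr => j _; rewrite tnth_mktuple mulrDr.
Qed.

Lemma measurable_lin_value D (c : 'I_D -> int) :
  measurable_fun setT (lin_value c : D.-tuple RT -> RT).
Proof.
apply: measurable_sum => j; apply: measurable_funM; first exact: measurable_cst.
exact: measurable_tnth.
Qed.

Variable (g : R -> R).
Hypotheses (mg : measurable_fun [set: RT] (g : RT -> RT)) (g0 : forall x, (0 <= g x)%R)
  (gp : forall x (m : int), g (x + m%:~R)%R = g x).
Variable (G : R).
Hypothesis (GE : \int[uniform_prob (@ltr01 R)]_t (g t)%:E = G%:E).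

Lemma measurable_prod_lin_value D k (c : 'I_k -> 'I_D -> int) :
  measurable_fun setT (fun a : D.-tuple RT => (\prod_(i < k) g (lin_value (c i) a))%R : RT).
Proof.
apply: measurable_prod => i _; apply: measurableT_comp => //; exact: measurable_lin_value.
Qed.

(** Independence provides a rational vector v on which the first form takes the
    value 1 and the others vanish. A translation by s v preserves the integral
    and only shifts the argument of the first factor, by s. Averaging over s in
    [0, 1] replaces this factor by its mean G, and the induction hypothesis
    applies to the other ones. *)
Lemma integral_prod_lin_value D k (c : 'I_k -> 'I_D -> int) :
  row_free (\matrix_(i, j) (c i j)%:~R : 'M[rat]_(k, D)) ->
  \int[lebesgue_cube R D]_a (\prod_(i < k) g (lin_value (c i) a))%:E = (G ^+ k)%:E.
Proof.
elim: k c => [|k IH] c.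
  move=> _; under eq_integral do rewrite big_ord0.
  exact: integral_prob_cst.
move=> /row_freeP[B MB].
pose c' i := c (lift ord0 i).
have free' : row_free (\matrix_(i, j) (c' i j)%:~R : 'M[rat]_(k, D)).
  apply/row_freeP; exists (colsub (lift ord0) B).
  apply/matrixP => i j; have /matrixP/(_ (lift ord0 i) (lift ord0 j)) := MB.
  rewrite !mxE (inj_eq lift_inj) => <-.
  by apply: eq_bigr => l _; rewrite !mxE.
(* The first column of a right inverse of the matrix of the forms. *)
pose v j : R := ratr (B j ord0).
have cv i : (\sum_j (c i j)%:~R * v j = (i == ord0)%:R)%R.
  have /matrixP/(_ i ord0) := MB; rewrite !mxE => E.
  rewrite -(ratr_nat R) -E rmorph_sum; apply: eq_bigr => j _.
  by rewrite !mxE rmorphM /= ratr_int.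
pose Phi a := (\prod_(i < k) g (lin_value (c' i) a))%R.
have Phi0 a : (0 <= Phi a)%R by apply: prodr_ge0.
have mPhi : measurable_fun setT (Phi : D.-tuple RT -> RT) by exact: measurable_prod_lin_value.
pose H (s : R) (a : D.-tuple R) := (g (lin_value (c ord0) a + s) * Phi a)%R.
have prodE a : (\prod_(i < k.+1) g (lin_value (c i) a) = H 0 a)%R.
  by rewrite big_ord_recl /H addr0.
have HE s : \int[lebesgue_cube R D]_a (H 0%R a)%:E = \int[lebesgue_cube R D]_a (H s a)%:E.
  rewrite -(integral_cube_shift (fun j => s * v j)%R).
  - apply: eq_integral => a _; rewrite /H addr0 lin_value_tshift.
    under eq_bigr do rewrite mulrCA.
    rewrite -mulr_sumr cv eqxx mulr1; congr (_ * _)%:E.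
    apply: eq_bigr => i _; rewrite lin_value_tshift.
    under eq_bigr do rewrite mulrCA.
    by rewrite -mulr_sumr cv /= mulr0 addr0.
  - apply/measurable_EFinP; rewrite (_ : H 0%R = fun a =>
      \prod_(i < k.+1) g (lin_value (c i) a))%R; last first.
      by apply/funext => a; rewrite prodE.
    exact: measurable_prod_lin_value.
  - by move=> a; rewrite lee_fin mulr_ge0.
  - move=> a m; rewrite -!prodE; congr (_%:E); apply: eq_bigr => i _.
    rewrite lin_value_tshift (_ : (\sum_j _ = (\sum_j c i j * m j)%:~R)%R) ?gp //.
    by rewrite rmorph_sum; apply: eq_bigr => j _; rewrite rmorphM.
under eq_integral do rewrite prodE.
transitivity (\int[uniform_prob (@ltr01 R)]_s \int[lebesgue_cube R D]_a (H s a)%:E).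
  under [RHS]eq_integral do rewrite -HE.
  by rewrite integral_prob_cst.
rewrite (@fubini_tonelli _ _ RT (D.-tuple RT) R (uniform_prob (@ltr01 R)) (lebesgue_cube R D)
    (fun z => (H z.1 z.2)%:E)).
- rewrite exprS EFinM -(IH c') // -ge0_integralZl //.
  + apply: eq_integral => a _; rewrite /= /H.
    under eq_integral do rewrite mulrC EFinM.
    rewrite ge0_integralZl //.
    * rewrite muleC -GE; congr (_ * _).
      under eq_integral do rewrite addrC.
      apply: (@integral_periodic_shift _ _ (fun x => (g x)%:E)) => //.
      - exact/measurable_EFinP.
      - by move=> x m; rewrite gp.
    * apply/measurable_EFinP; apply: measurableT_comp => //.
      by apply: measurable_funD => //; exact: measurable_cst.
    * by move=> x _; rewrite lee_fin.
    * by rewrite lee_fin.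
  + exact/measurable_EFinP.
  + by move=> x _; rewrite lee_fin; exact: Phi0.
  + by rewrite -GE; apply: integral_ge0 => x _; rewrite lee_fin.
- apply/measurable_EFinP; apply: measurable_funM; last exact: measurableT_comp.
  apply: measurableT_comp => //; apply: measurable_funD => //.
  by apply: measurableT_comp => //; exact: measurable_lin_value.
- by move=> z; rewrite lee_fin mulr_ge0.
Qed.
End Independence.

(** * Means of elementary symmetric functions of the hits *)

Section BoundedExpectation.
Context {R : realType} {d : measure_display} {T : measurableType d} (P : probability T R).

Definition bounded_meas (f : T -> R) :=
  measurable_fun setT f /\ exists M, forall x, `|f x| <= M.

Definition mean (f : T -> R) : R := \int[P]_x f x.

Lemma bounded_meas_integrable f : bounded_meas f -> P.-integrable setT (EFin \o f).
Proof.
move=> [mf [M fM]]; apply: measurable_bounded_integrable => //.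
  by rewrite /= probability_setT ltry.
exists M; split; first exact: num_real.
by move=> M' MM' x _ /=; apply: le_trans (fM x) (ltW MM').
Qed.

Lemma mean_EFin f : bounded_meas f -> (\int[P]_x (f x)%:E)%E = (mean f)%:E.
Proof.
move=> /bounded_meas_integrable H; rewrite /mean /Rintegral fineK //.
exact: integrable_fin_num.
Qed.

Lemma bounded_meas_cst c : bounded_meas (fun=> c).
Proof. by split; [exact: measurable_cst|exists `|c|]. Qed.

Lemma bounded_measD f g : bounded_meas f -> bounded_meas g -> bounded_meas (fun x => f x + g x).
Proof.
move=> [mf [M fM]] [mg [N gN]]; split; first exact: measurable_funD.
by exists (M + N) => x; apply: le_trans (ler_normD _ _) _; exact: lerD.
Qed.

Lemma bounded_measZ c f : bounded_meas f -> bounded_meas (fun x => c * f x).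
Proof.
move=> [mf [M fM]]; split; first by apply: measurable_funM => //; exact: measurable_cst.
by exists (`|c| * M) => x; rewrite normrM ler_wpM2l.
Qed.

Lemma bounded_meas_sum I (s : seq I) (Q : pred I) (f : I -> T -> R) :
  (forall i, bounded_meas (f i)) -> bounded_meas (fun x => \sum_(i <- s | Q i) f i x).
Proof.
move=> bf; elim: s => [|i s IH].
  rewrite (_ : (fun x => _) = fun=> 0); first exact: bounded_meas_cst.
  by apply/funext => x; rewrite big_nil.
rewrite (_ : (fun x => _) = fun x => (if Q i then f i x else 0) + \sum_(j <- s | Q j) f j x).
  by apply: bounded_measD => //; case: (Q i) => //; exact: bounded_meas_cst.
by apply/funext => x; rewrite big_cons; case: (Q i); rewrite ?add0r.
Qed.

Lemma meanD f g : bounded_meas f -> bounded_meas g -> mean (fun x =>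
    f x + g x) = mean f + mean g.
Proof. by move=> /bounded_meas_integrable bf /bounded_meas_integrable bg;
    exact: RintegralD. Qed.

Lemma meanZ c f : bounded_meas f -> mean (fun x => c * f x) = c * mean f.
Proof. by move=> /bounded_meas_integrable bf; exact: RintegralZl. Qed.

Lemma mean_cst c : mean (fun=> c) = c.
Proof. by rewrite /mean Rintegral_cst //= probability_setT /= mulr1. Qed.

Lemma meanB f g : bounded_meas f -> bounded_meas g -> mean (fun x =>
    f x - g x) = mean f - mean g.
Proof. by move=> /bounded_meas_integrable bf /bounded_meas_integrable bg;
    exact: RintegralB. Qed.

Lemma mean_sum I (s : seq I) (Q : pred I) (f : I -> T -> R) : (forall i, bounded_meas (f i)) ->
  mean (fun x => \sum_(i <- s | Q i) f i x) = \sum_(i <- s | Q i) mean (f i).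
Proof.
move=> bf; elim: s => [|i s IH].
  rewrite big_nil -[RHS](mean_cst 0); congr mean.
  by apply/funext => x; rewrite big_nil.
rewrite big_cons -IH.
have [Qi|Qi] := boolP (Q i).
  rewrite -meanD //; last exact: bounded_meas_sum.
  by congr mean; apply/funext => x; rewrite big_cons Qi.
by congr mean; apply/funext => x; rewrite big_cons (negbTE Qi).
Qed.

Lemma mean_le f g : bounded_meas f -> bounded_meas g -> (forall x, f x <= g x) ->
    mean f <= mean g.
Proof.
by move=> /bounded_meas_integrable bf /bounded_meas_integrable bg fg; apply: le_Rintegral.
Qed.

Lemma mean_ge0 f : (forall x, 0 <= f x) -> 0 <= mean f.
Proof. by move=> f0; apply: Rintegral_ge0. Qed.

Lemma mean_norm_le f g : bounded_meas f -> bounded_meas g -> (forall x, `|f x| <= g x) ->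
    `|mean f| <= mean g.
Proof.
move=> bf bg fg; rewrite ler_norml -mulN1r -meanZ //; apply/andP; split; apply: mean_le => //.
- exact: bounded_measZ.
- by move=> x; rewrite mulN1r; have := fg x; rewrite ler_norml => /andP[].
- by move=> x; have := fg x; rewrite ler_norml => /andP[].
Qed.
End BoundedExpectation.

Lemma prodr_le_inj (R : realFieldType) r k (I : 'I_r -> 'I_k) (x : 'I_k -> R) :
  injective I -> (forall i, 0 <= x i <= 1) -> \prod_i x i <= \prod_j x (I j).
Proof.
move=> Ij x01; rewrite (bigID (mem (I @: finset.setT))) /=.
rewrite big_imset /=; last by move=> i j _ _; exact: Ij.
rewrite (eq_bigl xpredT); last by move=> i; rewrite inE.
rewrite ler_piMr //; first by apply: prodr_ge0 => i _; case/andP: (x01 (I i)).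
by apply: prodr_ile1.
Qed.

Lemma dist_le_of_bounds (R : realFieldType) (x y z : R) :
  0 <= x <= z -> 0 <= y <= z -> `|x - y| <= z.
Proof. by move=> /andP[? ?] /andP[? ?]; rewrite ler_norml; apply/andP; split; lra. Qed.

Section SymmetricExpectation.
Context {R : realType}.
Notation RT := (measurableTypeR R).
Variables (g : R -> R) (G : R).
Hypotheses (mg : measurable_fun [set: RT] (g : RT -> RT)) (g01 : forall x, 0 <= g x <= 1)
  (gp : forall x (m : int), g (x + m%:~R) = g x)
  (GE : (\int[uniform_prob (@ltr01 R)]_t (g t)%:E = G%:E)%E).
Variables (D L : nat).
Notation pt := {ffun 'I_D -> 'I_L}.

Definition hit_weight (m : pt) (a : D.-tuple R) : R := g (lin_value (fun j => (m j).+1%:Z) a).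

Let P := lebesgue_cube R D.

Lemma weight_mean01 : 0 <= G <= 1.
Proof.
rewrite -!lee_fin -GE; apply/andP; split.
  by apply: integral_ge0 => x _; rewrite lee_fin; case/andP: (g01 x).
rewrite -(integral_prob_cst (uniform_prob (@ltr01 R)) 1%:E); apply: ge0_le_integral => //.
- by move=> x _; rewrite lee_fin; case/andP: (g01 x).
- exact/measurable_EFinP.
- by move=> x _; rewrite lee_fin; case/andP: (g01 x).
Qed.

Lemma bounded_hit_prod k (f : 'I_k -> pt) :
  bounded_meas (fun a : D.-tuple RT => \prod_(i < k) hit_weight (f i) a).
Proof.
split.
  by apply: measurable_prod => i _; apply: (measurableT_comp mg); exact: measurable_lin_value.
exists 1 => a; rewrite ger0_norm; last first.
  by apply: prodr_ge0 => i _; case/andP: (g01 (lin_value (fun j => (f i j).+1%:Z) a)).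
by apply: prodr_ile1 => i _; exact: g01.
Qed.

Lemma bounded_void :
  bounded_meas (fun a : D.-tuple RT => \prod_(m : pt) (1 - hit_weight m a)).
Proof.
have w01 m a : 0 <= 1 - hit_weight m a <= 1.
  rewrite /hit_weight; have /andP[h0 h1] := g01 (lin_value (fun j => (m j).+1%:Z) a).
  by rewrite subr_ge0 h1 gerBl.
split.
  apply: measurable_prod => m _; apply: measurable_funB; first exact: measurable_cst.
  by apply: (measurableT_comp mg); exact: measurable_lin_value.
exists 1 => a; rewrite ger0_norm; first by apply: prodr_ile1 => m _; exact: w01.
by apply: prodr_ge0 => m _; case/andP: (w01 m a).
Qed.

Lemma mean_hit_prod k (f : {ffun 'I_k -> pt}) : row_free (point_mx f) ->
  mean P (fun a => \prod_(i < k) hit_weight (f i) a) = G ^+ k.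
Proof.
move=> free; apply: EFin_inj; rewrite -mean_EFin; last exact: bounded_hit_prod.
rewrite -(integral_prod_lin_value mg _ gp GE (c := fun i j => (f i j).+1%:Z)) //.
  by move=> x; case/andP: (g01 x).
Qed.

(** Only the factors of a maximal independent set of vectors are kept, the other
    ones being at most 1. *)
Lemma mean_hit_prod_dependent k (f : {ffun 'I_k -> pt}) :
  `|mean P (fun a => \prod_(i < k) hit_weight (f i) a) - G ^+ k| <=
   if \rank (point_mx f) == k then 0 else G ^+ \rank (point_mx f).
Proof.
have /andP[G0 G1] := weight_mean01.
case: eqP => [rk|_]; first by rewrite mean_hit_prod ?subrr ?normr0 // /row_free rk.
set r := \rank _.
pose I := maxrankfun (point_mx f).
have rk : (r <= k)%N by rewrite rank_leq_row.
have le1 : mean P (fun a => \prod_(i < k) hit_weight (f i) a) <= G ^+ r.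
  rewrite -(@mean_hit_prod r [ffun i => f (I i)]); last first.
    rewrite (_ : point_mx _ = rowsub I (point_mx f)); first exact: maxrowsub_free.
    by apply/matrixP => i j; rewrite !mxE !ffunE.
  apply: mean_le; [exact: bounded_hit_prod|exact: bounded_hit_prod|move=> a].
  apply: le_trans (prodr_le_inj (@maxrankfun_inj _ _ _ (point_mx f)) _) _.
    by move=> i; exact: g01.
  by apply: ler_prod => i _; rewrite ffunE lexx andbT;
      case/andP: (g01 (lin_value (fun j => (f (I i) j).+1%:Z) a)).
have ge0 : 0 <= mean P (fun a => \prod_(i < k) hit_weight (f i) a).
  by apply: mean_ge0 => a; apply: prodr_ge0 => i _;
      case/andP: (g01 (lin_value (fun j => (f i j).+1%:Z) a)).
have Gk : 0 <= G ^+ k <= G ^+ r by rewrite exprn_ge0 //= ler_wiXn2l.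
by apply: dist_le_of_bounds => //; rewrite ge0.
Qed.

(** If all sets of k vectors were independent, each would contribute G^k; a
    dependent set of rank r causes an error of at most G^r. *)
Lemma mean_elem_sym_approx (m0 : pt) k :
  `|mean P (fun a => elem_sym (hit_weight ^~ a) k) - ('C(L ^ D, k))%:R * G ^+ k| <=
  \sum_(r < k) #|dependent_tuples k D L r|%:R * G ^+ r.
Proof.
have /andP[G0 G1] := weight_mean01.
pose f (A : {set pt}) : {ffun 'I_k -> pt} := [ffun i : 'I_k => nth m0 (enum A) i].
have prodE (A : {set pt}) a : #|A| == k ->
    \prod_(m in A) hit_weight m a = \prod_(i < k) hit_weight (f A i) a.
  move=> /eqP Ak; rewrite -big_enum /= (big_nth m0) -cardE Ak big_mkord.
  by apply: eq_bigr => i _; rewrite ffunE.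
have f_inj (A : {set pt}) : #|A| == k -> injectiveb (f A).
  move=> /eqP Ak; apply/injectiveP => i j; rewrite !ffunE => /eqP.
  by rewrite nth_uniq ?enum_uniq // -?cardE ?Ak // => /eqP/val_inj.
have f_rec (A : {set pt}) : #|A| == k -> A = [set f A i | i in finset.setT]%SET.
  move=> /eqP Ak; apply/setP => m; apply/idP/imsetP => [mA|[i _ ->]].
    have mi : (index m (enum A) < k)%N by rewrite -Ak cardE index_mem mem_enum.
    by exists (Ordinal mi) => //; rewrite ffunE nth_index // mem_enum.
  by rewrite ffunE -mem_enum mem_nth // -cardE Ak.
rewrite (_ : mean P _ = \sum_(A : {set pt} | #|A| == k) mean P (fun a =>
    \prod_(i < k) hit_weight (f A i) a)); last first.
  rewrite -mean_sum; last by move=> A; exact: bounded_hit_prod.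
  by congr mean; apply/funext => a; apply: eq_bigr => A Ak; rewrite prodE.
rewrite (_ : ('C(_, _))%:R * _ = \sum_(A : {set pt} | #|A| == k) G ^+ k); last first.
  rewrite sumr_const -[RHS]mulr_natl; congr (_%:R * _).
  have := card_draws pt k; rewrite card_ffun !card_ord => <-.
  by apply: eq_card => A; rewrite inE.
rewrite -sumrB; apply: le_trans (ler_norm_sum _ _ _) _.
apply: (@le_trans _ _ (\sum_(A : {set pt} | #|A| == k) \sum_(r < k | \rank (point_mx (f A)) ==
    r) G ^+ r)).
  apply: ler_sum => A Ak; apply: le_trans (mean_hit_prod_dependent _) _.
  have := rank_leq_row (point_mx (f A)); rewrite leq_eqVlt; case: eqP => [_ _|_ /= rk].
    by apply: sumr_ge0 => r _; exact: exprn_ge0.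
  rewrite (bigD1 (Ordinal rk)) //= lerDl; apply: sumr_ge0 => r _; exact: exprn_ge0.
rewrite (exchange_big_dep xpredT) //=; apply: ler_sum => r _.
rewrite sumr_const -[X in X <= _]mulr_natl ler_wpM2r ?exprn_ge0 // ler_nat.
rewrite -(@card_in_imset _ _ f) /=; last first.
  move=> A B /andP[Ak _] /andP[Bk _] E.
  by rewrite (f_rec A Ak) (f_rec B Bk) E.
apply: subset_leq_card; apply/fintype.subsetP => _ /imsetP[A + ->].
by rewrite !inE => /andP[Ak ->]; rewrite f_inj.
Qed.
End SymmetricExpectation.

(** * The probability generating function for large dimension *)

Definition eventually_small (R : realType) (f : nat -> R) :=
  forall e, 0 < e -> exists n0 : nat, forall n, (n0 <= n)%N -> f n <= e.

Lemma eventually_small_sum (R : realType) (f : nat -> nat -> R) K :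
  (forall k, eventually_small (f k)) -> eventually_small (fun n => \sum_(k < K) f k n).
Proof.
move=> fs; elim: K => [|K IH] e e0.
  by exists 0%N => n _; rewrite big_ord0 ltW.
have e2 : 0 < e / 2 by lra.
have [n1 n1P] := IH _ e2; have [n2 n2P] := fs K _ e2.
exists (maxn n1 n2) => n; rewrite geq_max => /andP[/n1P h1 /n2P h2].
by rewrite big_ord_recr /=; lra.
Qed.

Lemma eventually_small_cvg0 (R : realType) (f : nat -> R) :
  f @ \oo --> 0 -> eventually_small f.
Proof.
move=> f0 e e0; have /cvgrPdist_le/(_ e e0)[n0 _ H] := f0.
exists n0 => n nn; have := H n nn; rewrite /= sub0r normrN.
exact/le_trans/ler_norm.
Qed.

Lemma eventually_small_geom (R : realType) (c : R) d :
  eventually_small (fun n => c * (8 / 9) ^+ (n - d)).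
Proof.
apply: eventually_small_cvg0; rewrite -[X in _ --> X](mulr0 c).
apply: cvgM; first exact: cvg_cst.
rewrite -(cvg_shiftn d) /=.
under eq_fun do rewrite addnK.
by apply: cvg_expr; rewrite ger0_norm //; lra.
Qed.

Lemma eventually_small_inv (R : realType) (c : R) :
  eventually_small (fun n => c / n%:R).
Proof.
apply: eventually_small_cvg0; rewrite -[X in _ --> X](mulr0 c).
apply: cvgM; first exact: cvg_cst.
rewrite -(cvg_shiftS (fun n => n%:R^-1 : R)); exact: cvg_harmonic.
Qed.

Section ExpTail.
Variable R : realType.

Definition exp_tail (s : R) K : R := expR s - series (exp_coeff s) K.

Lemma exp_tail_small (s : R) : eventually_small (exp_tail s).
Proof.
apply: eventually_small_cvg0; rewrite -(subrr (expR s)).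
apply: cvgB; first exact: cvg_cst.
exact: is_cvg_series_exp_coeff.
Qed.

Lemma series_exp_le (s : R) m n : 0 <= s -> (n <= m)%N ->
  series (exp_coeff s) n <= series (exp_coeff s) m.
Proof.
move=> s0 nm; rewrite /series /= (big_cat_nat (leq0n n) nm) /= lerDl.
by apply: sumr_ge0 => i _; rewrite /exp_coeff /= divr_ge0 // exprn_ge0.
Qed.

(** The bound is uniform for |c| <= s; it will be used with a c that varies with
    N. *)
Lemma exp_tail_bound (c s : R) K : `|c| <= s ->
  `|expR c - series (exp_coeff c) K| <= exp_tail s K.
Proof.
move=> cs; have s0 : 0 <= s by apply: le_trans cs.
have H m : (K <= m)%N -> `|series (exp_coeff c) m - series (exp_coeff c) K| <=
    series (exp_coeff s) m - series (exp_coeff s) K.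
  move=> Km; rewrite /series /= !(big_cat_nat (leq0n K) Km) /=.
  rewrite ![_ + _ - _]addrAC !subrr !add0r.
  apply: le_trans (ler_norm_sum _ _ _) _; apply: ler_sum => i _.
  rewrite /exp_coeff /= normrM normfV normr_nat normrX.
  by rewrite ler_wpM2r // lerXn2r ?nnegrE.
have cv (x : R) : series (exp_coeff x) m - series (exp_coeff x) K @[m --> \oo] -->
    expR x - series (exp_coeff x) K.
  by apply: cvgB; [exact: is_cvg_series_exp_coeff|exact: cvg_cst].
have cvn : `|series (exp_coeff c) m - series (exp_coeff c) K| @[m --> \oo] --> `|expR c -
    series (exp_coeff c) K| by exact: cvg_norm (cv c).
rewrite /exp_tail; apply: (ler_cvg_to cvn (cv s)).
by exists K => // m; exact: H.
Qed.

Lemma pow_fact_le_tail (s : R) K : 0 <= s -> s ^+ K / (K`!)%:R <= exp_tail s K.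
Proof.
move=> s0; have : series (exp_coeff s) K.+1 <= expR s.
  apply: nondecreasing_cvgn_le; last exact: is_cvg_series_exp_coeff.
  by move=> n m; exact: series_exp_le.
by rewrite /series /= big_nat_recr //= /exp_tail /series /= -lerBrDl.
Qed.
End ExpTail.

Section VoidProbability.
Context {R : realType}.
Notation RT := (measurableTypeR R).

Definition dep_coef (s : R) k : R := k%:R * (1 + s) ^+ k * (k ^ k)%:R.

Lemma mean_elem_sym_poisson (g : R -> R) (G s : R) (D L N k : nat) :
  measurable_fun [set: RT] (g : RT -> RT) -> (forall x, 0 <= g x <= 1) ->
  (forall x (m : int), g (x + m%:~R) = g x) ->
  (\int[uniform_prob (@ltr01 R)]_t (g t)%:E = G%:E)%E ->
  (2 * (k * k) + 2 <= D)%N -> (2 <= L)%N -> (k <= L)%N -> (L ^ D <= N < L.+1 ^ D)%N ->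
  N%:R * G <= s ->
  `|mean (lebesgue_cube R D) (fun a => elem_sym ((hit_weight g (L :=
      L)) ^~ a) k) - (N%:R * G) ^+ k / (k`!)%:R| <=
  dep_coef s k * (6 ^+ (k * k) * 2 ^+ (2 * (k * k) + 2) * 2) * (8 / 9) ^+ (D - (2 * (k * k) +
      2)) +
  (dep_coef s k + (1 + s) ^+ k * (k * (D + k))%:R) / L%:R.
Proof.
move=> mg g01 gp GE D0 L2 kL nN NGs.
have /andP[G0 G1] := weight_mean01 mg g01 GE.
have L0 : (0 < L)%N by apply: leq_trans L2.
have L0' : 0 < L%:R :> R by rewrite ltr0n.
have nN' : (L ^ D <= N)%N by case/andP: nN.
have N0 : 0 < N%:R :> R by rewrite ltr0n (leq_trans _ nN') // expn_gt0 L0.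
have c0 : 0 <= N%:R * G by rewrite mulr_ge0 // ltW.
have s0 : 0 <= s by apply: le_trans NGs.
have powle r : (r <= k)%N -> (N%:R * G) ^+ r <= (1 + s) ^+ k.
  move=> rk; apply: (@le_trans _ _ ((1 + s) ^+ r)).
    by apply: lerXn2r; rewrite ?nnegrE //; lra.
  by apply: ler_weXn2l => //; lra.
have m0 : {ffun 'I_D -> 'I_L} by exact: [ffun=> Ordinal L0].
have H1 := mean_elem_sym_approx mg g01 gp GE m0 k.
apply: le_trans (ler_distD (('C(L ^ D, k))%:R * G ^+ k) _ _) _.
set a8 := (8 / 9) ^+ _; set A := 6 ^+ _ * _ * _.
have a80 : 0 <= a8 by rewrite exprn_ge0.
have A0 : 0 <= A by rewrite !mulr_ge0 // exprn_ge0.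
rewrite [X in _ <= X](_ : _ = dep_coef s k * (A * a8 + L%:R^-1) + (1 + s) ^+ k * ((k * (D +
    k))%:R / L%:R)); last by ring.
apply: lerD.
- apply: (le_trans H1).
  apply: (@le_trans _ _ (\sum_(r < k) (1 + s) ^+ k * (k ^ k)%:R * (A * a8 + L%:R^-1)));
      last first.
    by rewrite sumr_const card_ord -[X in X <= _]mulr_natl /dep_coef !mulrA.
  apply: ler_sum => r _.
  have := card_dependent R (ltn_ord r) L2 D0; rewrite -/a8 -/A => H2.
  have p1 : L%:R ^+ (k * k) / L%:R ^+ D <= L%:R^-1 :> R.
    rewrite ler_pdivrMr ?exprn_gt0 // mulrC ler_pdivlMr // -exprSr.
    by apply: ler_weXn2l; [rewrite ler1n|lia].
  apply: le_trans (ler_wpM2r (exprn_ge0 r G0) H2) _.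
  rewrite mulnC expnM natrX.
  have -> : ((L ^ D)%:R ^+ r * (k ^ k)%:R * (A * a8 + L%:R ^+ (k * k) / L%:R ^+ D)) * G ^+ r =
    ((L ^ D)%:R * G) ^+ r * ((k ^ k)%:R * (A * a8 + L%:R ^+ (k * k) / L%:R ^+ D)) :> R.
    by rewrite exprMn; ring.
  rewrite -[X in _ <= X]mulrA; apply: ler_pM.
  + by rewrite exprn_ge0 // mulr_ge0.
  + by rewrite mulr_ge0 // addr_ge0 ?mulr_ge0 // divr_ge0 // exprn_ge0 // ltW.
  + apply: le_trans (powle r (ltnW (ltn_ord r))).
    apply: lerXn2r; rewrite ?nnegrE ?mulr_ge0 // ?(ltW N0) //.
    by apply: ler_wpM2r => //; rewrite ler_nat.
  + by apply: ler_wpM2l => //; rewrite lerD2l.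
- have -> : ('C(L ^ D, k))%:R * G ^+ k - (N%:R * G) ^+ k / (k`!)%:R =
     (N%:R * G) ^+ k * (('C(L ^ D, k))%:R / N%:R ^+ k - (k`!)%:R^-1).
    rewrite exprMn mulrBr; congr (_ - _).
    by field; rewrite expf_neq0 // gt_eqF.
  rewrite normrM ger0_norm ?exprn_ge0 //; apply: ler_pM => //; first by rewrite exprn_ge0.
    exact: powle.
  by apply: bin_approx => //; lia.
Qed.

(** In this order: the truncation error at order K, the contribution of
    dependent tuples that decays with D, and the terms that vanish when L grows
    and D is fixed. *)
Definition void_error (s : R) K D L : R :=
  exp_tail s K *+ 2 +
  \sum_(k < K.+1) dep_coef s k * (6 ^+ (k * k) * 2 ^+ (2 * (k * k) +
      2) * 2) * (8 / 9) ^+ (D - (2 * (k * k) + 2)) +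
  \sum_(k < K.+1) (dep_coef s k + (1 + s) ^+ k * (k * (D + k))%:R) / L%:R.

(** Bonferroni's inequality for the product and the Taylor expansion of the
    exponential are both truncated at order K and compared term by term. *)
Lemma void_prob_bound (g : R -> R) (G s : R) (D L N K : nat) :
  measurable_fun [set: RT] (g : RT -> RT) -> (forall x, 0 <= g x <= 1) ->
  (forall x (m : int), g (x + m%:~R) = g x) ->
  (\int[uniform_prob (@ltr01 R)]_t (g t)%:E = G%:E)%E ->
  (2 * (K * K) + 2 <= D)%N -> (2 <= L)%N -> (K <= L)%N -> (L ^ D <= N < L.+1 ^ D)%N ->
  N%:R * G <= s ->
  `|mean (lebesgue_cube R D) (fun a => \prod_(m : {ffun 'I_D -> 'I_L}) (1 - hit_weight g m a)) -
    expR (- (N%:R * G))| <= void_error s K D L.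
Proof.
move=> mg g01 gp GE D0 L2 KL nN NGs.
have /andP[G0 G1] := weight_mean01 mg g01 GE.
set c := N%:R * G in NGs *.
have c0 : 0 <= c by rewrite mulr_ge0.
have s0 : 0 <= s by apply: le_trans NGs.
pose P := lebesgue_cube R D.
pose e (k : nat) (a : D.-tuple R) := elem_sym ((hit_weight g (L := L)) ^~ a) k.
pose V (a : D.-tuple R) := \prod_(m : {ffun 'I_D -> 'I_L}) (1 - hit_weight g m a).
have be k : bounded_meas (e k : D.-tuple RT -> R).
  apply: bounded_meas_sum => A.
  rewrite (_ : (fun x => _) = (fun x => \prod_(i < #|A|) hit_weight g (enum_val i) x)).
    exact: bounded_hit_prod.
  by apply/funext => x; rewrite big_enum_val.
have bV : bounded_meas (V : D.-tuple RT -> R) by exact: bounded_void.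
pose err k : R := dep_coef s k * (6 ^+ (k * k) * 2 ^+ (2 * (k * k) +
    2) * 2) * (8 / 9) ^+ (D - (2 * (k * k) + 2)) +
  (dep_coef s k + (1 + s) ^+ k * (k * (D + k))%:R) / L%:R.
have ek k : (k <= K)%N -> `|mean P (e k) - c ^+ k / (k`!)%:R| <= err k.
  move=> kK; apply: mean_elem_sym_poisson => //; [|lia].
  by apply: leq_trans D0; rewrite leq_add2r leq_mul2l leq_mul.
pose F (a : D.-tuple R) := \sum_(k < K) (-1) ^+ k * e k a.
have bF : bounded_meas (F : D.-tuple RT -> R).
  by apply: bounded_meas_sum => k; apply: bounded_measZ; exact: be.
have ExF : mean P F = \sum_(k < K) (-1) ^+ k * mean P (e k).
  rewrite mean_sum; last by move=> k; apply: bounded_measZ; exact: be.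
  by apply: eq_bigr => k _; rewrite meanZ //; exact: be.
have h1 : `|mean P V - mean P F| <= mean P (e K).
  rewrite -meanB //; apply: mean_norm_le.
  - rewrite (_ : (fun x => _) = (fun x => V x + (-1) * F x)); last by apply/funext => x;
      rewrite mulN1r.
    by apply: bounded_measD => //; exact: bounded_measZ.
  - exact: be.
  - by move=> a; apply: bonferroni => m; exact: g01.
have h2 : mean P (e K) <= exp_tail s K + err K.
  have := ek K (leqnn K); rewrite ler_distl => /andP[_ H].
  apply: (le_trans H); rewrite lerD2r; apply: le_trans (pow_fact_le_tail K s0).
  by rewrite ler_wpM2r // lerXn2r ?nnegrE.
have h3 : `|mean P F - series (exp_coeff (- c)) K| <= \sum_(k < K) err k.
  rewrite ExF /series /= big_mkord -sumrB.
  apply: le_trans (ler_norm_sum _ _ _) _; apply: ler_sum => k _.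
  rewrite /exp_coeff /= (exprNn c) -[X in _ - X]mulrA -mulrBr normrMsign.
  by apply: ek; apply: ltnW.
have h4 : `|expR (- c) - series (exp_coeff (- c)) K| <= exp_tail s K.
  by apply: exp_tail_bound; rewrite normrN ger0_norm.
have errS : \sum_(k < K.+1) err k = \sum_(k < K) err k + err K by rewrite big_ord_recr.
rewrite /void_error -addrA -big_split /= mulr2n.
rewrite [X in _ <= _ + X](_ : _ = \sum_(k < K.+1) err k) // errS.
move: h1 h2 h3 h4; rewrite -/V -/P !ler_norml.
move: (mean P V) (mean P F) (mean P (e K)) (series _ K) => x y z w.
move: (\sum_(k < K) err k) (err K) (exp_tail s K) (expR (- c)) => u v t q.
by move=> /andP[? ?] ? /andP[? ?] /andP[? ?]; apply/andP; split; lra.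
Qed.

(** The order of choices is K, then D, then L, as in the iterated limit. The
    function g is quantified last because it depends on N. *)
Lemma void_prob_limit (s e : R) : 0 < e -> exists D0 : nat, forall D, (D0 <= D)%N ->
  exists L0 : nat, forall L N : nat, (L0 <= L)%N -> (L ^ D <= N < L.+1 ^ D)%N ->
  forall (g : R -> R) (G : R),
  measurable_fun [set: RT] (g : RT -> RT) -> (forall x, 0 <= g x <= 1) ->
  (forall x (m : int), g (x + m%:~R) = g x) ->
  (\int[uniform_prob (@ltr01 R)]_t (g t)%:E = G%:E)%E ->
  N%:R * G <= s ->
  `|mean (lebesgue_cube R D) (fun a => \prod_(m : {ffun 'I_D -> 'I_L}) (1 - hit_weight g m a)) -
    expR (- (N%:R * G))| <= e.
Proof.
move=> e0; have e4 : 0 < e / 4 by lra.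
have [K /(_ K (leqnn K)) KP] := @exp_tail_small _ s _ e4.
have [D1 D1P] := @eventually_small_sum _ _ K.+1 (fun k => eventually_small_geom
  (dep_coef s k * (6 ^+ (k * k) * 2 ^+ (2 * (k * k) + 2) * 2)) (2 * (k * k) + 2)) _ e4.
exists (maxn D1 (2 * (K * K) + 2)) => D; rewrite geq_max => /andP[/D1P DP DK].
have [L1 L1P] := @eventually_small_sum _ _ K.+1 (fun k => eventually_small_inv
  (dep_coef s k + (1 + s) ^+ k * (k * (D + k))%:R)) _ e4.
exists (maxn L1 (maxn 2 K)) => L N;
    rewrite !geq_max => /and3P[/L1P LP L2 LK] nN g G mg g01 gp GE NGs.
apply: le_trans (void_prob_bound mg g01 gp GE DK L2 LK nN NGs) _.
by rewrite /void_error; lra.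
Qed.
End VoidProbability.

(** * Hit counts as sums over lattice vectors *)

Lemma nat_root_exists (D N : nat) : (0 < D)%N -> exists L : nat, (L ^ D <= N < L.+1 ^ D)%N.
Proof.
move=> D0.
have H : exists l : nat, (l ^ D <= N)%N by exists 0%N; rewrite exp0n.
have B l : (l ^ D <= N)%N -> (l <= N)%N.
  by apply: leq_trans; rewrite -{1}(expn1 l); case: l => // l; rewrite leq_pexp2l.
case: (ex_maxnP H B) => L LN max; exists L; rewrite LN ltnNge.
by apply/negP => /max; rewrite ltnn.
Qed.

Section HitCount.
Context {R : realType}.

Definition in_arc (xi tau sigma : R) (N : nat) (t : R) : bool :=
  `[< exists j : int, xi + tau / N%:R < t + j%:~R < xi + (tau + sigma) / N%:R >].

Lemma le_root (D N L n : nat) : (0 < D)%N -> (L ^ D <= N < L.+1 ^ D)%N ->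
  (n.+1%:R <= N%:R `^ (D%:R)^-1 :> R) = (n < L)%N.
Proof.
move=> D0 /andP[LN NL].
have D0' : D%:R != 0 :> R by rewrite pnatr_eq0 -lt0n.
rewrite -(@ler_pXn2r _ D) ?nnegrE ?powR_ge0 //.
rewrite -[X in _ <= X]powR_mulrn ?powR_ge0 // -powRrM mulVf // powRr1 //.
rewrite -natrX ler_nat; apply/idP/idP => [nN|nL].
  by rewrite -ltnS -(ltn_exp2r _ _ D0); apply: leq_ltn_trans NL.
by apply: leq_trans LN; rewrite leq_exp2r.
Qed.

(** The arc has length at most 1, so a vector of first coordinates has at most
    one last coordinate. *)
Lemma hit_countE (d N L : nat) (xi tau sigma : R) (alpha : d.-1.-tuple R) :
  (0 < d.-1)%N -> (0 < N)%N -> sigma <= N%:R -> (L ^ d.-1 <= N < L.+1 ^ d.-1)%N ->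
  hit_count N xi `]tau, (tau + sigma)[ alpha =
  (\sum_(m : {ffun 'I_d.-1 -> 'I_L}) in_arc xi tau sigma N (lin_value (fun j =>
      (m j).+1%:Z) alpha))%N.
Proof.
move=> D0 N0 sN LN.
have N0' : 0 < N%:R :> R by rewrite ltr0n.
pose B (m : {ffun 'I_d.-1 -> 'I_L}) :=
    in_arc xi tau sigma N (lin_value (fun j => (m j).+1%:Z) alpha).
pose last_hit (m : {ffun 'I_d.-1 -> 'I_L}) (j : int) :=
  xi + tau / N%:R < lin_value (fun j => (m j).+1%:Z) alpha + j%:~R < xi + (tau + sigma) / N%:R.
pose last (m : {ffun 'I_d.-1 -> 'I_L}) : int := xget 0 [set j | last_hit m j].
have lastE m : B m -> last_hit m (last m).
  by move=> /asboolP[j jP]; rewrite /last; case: xgetP => [k _ //|/(_ j)].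
have last_uniq m j : last_hit m j -> j = last m.
  move=> jP; have Bm : B m by apply/asboolP; exists j.
  move: jP (lastE _ Bm) => /andP[h1 h2] /andP[h3 h4].
  have : (tau + sigma) / N%:R <= tau / N%:R + 1 by rewrite mulrDl lerD2l ler_pdivrMr // mul1r.
  move=> h5.
  have : `|(j - last m)%:~R| < 1 :> R by rewrite rmorphB /= ltr_norml; apply/andP; split; lra.
  rewrite -intr_norm -[X in _ < X](mulr1z 1) ltr_int; lia.
pose phi (m : {ffun 'I_d.-1 -> 'I_L}) : d.-1.-tuple int * int :=
  ([tuple ((m j).+1%:Z) | j < d.-1], last m).
have phi_inj : injective phi.
  move=> m m' /(congr1 fst) E; apply/ffunP => j.
  have := congr1 (fun t : d.-1.-tuple int => tnth t j) E.
  by rewrite !tnth_mktuple => -[/val_inj].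
rewrite /hit_count.
have -> : hits N xi `]tau, (tau + sigma)[ alpha =
    [set` [fset x in [seq phi m | m <- enum B]]%fset].
  apply/seteqP; split.
    move=> [mt j] [/= bx [s]]; rewrite in_itv /= => /andP[s1 s2] E.
    have posm i : exists n : 'I_L, tnth mt i = n.+1%:Z.
      have /andP[] := bx i; rewrite tnth_map /= ltr0z.
      case: (tnth mt i) => // -[//|n] _; rewrite -pmulrn (le_root _ D0 LN) => nL.
      by exists (Ordinal nL).
    have [m mE] : exists m : {ffun 'I_d.-1 -> 'I_L}, forall i, tnth mt i = (m i).+1%:Z.
      have [f fE] := choice posm.
      by exists [ffun i => f i] => i; rewrite ffunE.
    have ld : lin_value (fun j => (m j).+1%:Z) alpha =
        \sum_(i < d.-1) (tnth mt i)%:~R * tnth alpha i.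
      by apply: eq_bigr => i _; rewrite mE.
    have jP : last_hit m j.
      by rewrite /last_hit ld -E !ltrD2l !ltr_pM2r ?invr_gt0 // s1 s2.
    rewrite /= !inE; apply/mapP; exists m.
      by rewrite mem_enum; apply/asboolP; exists j.
    rewrite /phi -(last_uniq _ _ jP); congr (_, _).
    by apply: eq_from_tnth => i; rewrite tnth_mktuple.
  move=> x /=; rewrite !inE => /mapP[m]; rewrite mem_enum => Bm ->.
  split => /=.
    move=> i; rewrite tnth_map tnth_mktuple ltr0z /= -pmulrn (le_root _ D0 LN).
    by rewrite ltn_ord.
  have /andP[h1 h2] := lastE _ Bm.
  set t := lin_value _ _ + _ in h1 h2.
  exists ((t - xi) * N%:R).
    rewrite in_itv /=; apply/andP; split.
      by rewrite -ltr_pdivrMr //; lra.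
    by rewrite -ltr_pdivlMr //; lra.
  rewrite mulfK ?gt_eqF // addrC subrK /t; congr (_ + _).
  by apply: eq_bigr => i _; rewrite tnth_mktuple.
rewrite set_fsetK card_fseq undup_id ?size_map; last first.
  by rewrite map_inj_uniq ?enum_uniq.
rewrite -cardE -sum1_card big_mkcond /=; apply: eq_bigr => m _.
by rewrite unfold_in /B; case: in_arc.
Qed.
End HitCount.

(** * Generating functions and weak limits of laws on count vectors *)

Section CountVectors.
Context {R : realType}.
Variable n : nat.
Notation vec := (n.-tuple nat).

Lemma measurable_vec (A : set vec) : measurable A.
Proof.
apply: countable_measurable; last first.
  exact: countableP.
move=> k; rewrite (_ : [set k] = \big[setI/setT]_(j < n) ((fun x : vec =>
    tnth x j) @^-1` [set tnth k j])).
  apply: bigsetI_measurable => j _; rewrite -[X in measurable X]setTI.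
  by apply: measurable_tnth.
apply/seteqP; split=> x /=; rewrite -bigcap_seq /=.
  by move=> -> j _.
move=> h; apply: eq_from_tnth => j; apply: (h j) => /=; exact: mem_index_enum.
Qed.

Lemma bounded_test_meas (f : vec -> R) : bounded_test f -> bounded_meas f.
Proof. by move=> bf; split => // _ Y _; rewrite setTI; exact: measurable_vec. Qed.

(** The mean of this function is the probability generating function at z. *)
Definition pgf_fun (z : 'I_n -> R) (x : vec) : R := \prod_j z j ^+ tnth x j.

Lemma pgf_fun01 z x : (forall j, 0 <= z j <= 1) -> 0 <= pgf_fun z x <= 1.
Proof.
move=> z01; apply/andP; split.
  by apply: prodr_ge0 => j _; rewrite exprn_ge0 //; case/andP: (z01 j).
by apply: prodr_ile1 => j _; have /andP[h1 h2] := z01 j; rewrite exprn_ge0 // exprn_ile1.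
Qed.

Lemma bounded_pgf_fun z : (forall j, 0 <= z j <= 1) -> bounded_test (pgf_fun z).
Proof. by move=> z01; exists 1 => x; have /andP[h0 h1] := pgf_fun01 x z01;
    rewrite ger0_norm. Qed.

(** The functions whose means converge along a sequence of probabilities form
    such a class ([mean_cvg_closed]). *)
Definition mean_closed (X : Type) (F : (X -> R) -> Prop) :=
  [/\ forall f g, F f -> F g -> F (fun x => f x + g x),
      forall c f, F f -> F (fun x => c * f x) &
      forall f, (forall e, 0 < e -> exists2 g, F g & forall x, `|f x - g x| <= e) -> F f].

Lemma mean_closed_sum (X : Type) (F : (X -> R) -> Prop) (I : Type) (s : seq I) (f : I -> X ->
    R) :
  mean_closed F -> F (fun=> 0) -> (forall i, F (f i)) -> F (fun x => \sum_(i <- s) f i x).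
Proof.
move=> [FD FZ FL] F0 Ff; elim: s => [|i s IH].
  by rewrite (_ : (fun x => _) = fun=> 0) //; apply/funext => x; rewrite big_nil.
rewrite (_ : (fun x => _) = fun x => f i x + \sum_(i <- s) f i x); first exact: FD.
by apply/funext => x; rewrite big_cons.
Qed.

(** Divide by z^i what remains of the function z^k after removal of its values
    at k < i: the result is 1 at i, and at most z beyond i. *)
Lemma mean_closed_point (F : (nat -> R) -> Prop) : mean_closed F ->
  (forall z, 0 <= z <= 1 -> F (fun k => z ^+ k)) -> forall i, F (fun k => (k == i)%:R).
Proof.
move=> Fc Fz i; have [FD FZ FL] := Fc.
have F0 : F (fun=> 0).
  rewrite (_ : (fun=> 0) = fun k => 0 * 0 ^+ k); first by apply: (FZ); apply: (Fz);
      rewrite lexx ler01.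
  by apply/funext => k; rewrite mul0r.
elim/ltn_ind: i => i IH; apply: (FL) => e e0.
pose z : R := Num.min e (1 / 2).
have z0 : 0 < z by rewrite /z lt_min e0 /=; lra.
have z1 : z <= 1 by rewrite /z ge_min; apply/orP; right; lra.
have ze : z <= e by rewrite /z ge_min lexx.
exists (fun k => z ^- i * (z ^+ k +
    (-1) * \sum_(i' <- iota 0 i) z ^+ i' * (if (i' < i)%N then (k == i')%:R else 0))).
  apply: (FZ); apply: (FD); first by apply: (Fz); rewrite z1 ltW.
  apply: (FZ); apply: mean_closed_sum => // i'; apply: (FZ); case: (ltnP i' i) => ii;
      [exact: IH|exact: F0].
move=> k; have zi0 : z ^+ i != 0 by rewrite expf_neq0 // gt_eqF.
have sE : \sum_(i' <- iota 0 i) z ^+ i' * (if (i' < i)%N then (k == i')%:R else 0) =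
    if (k < i)%N then z ^+ k else 0.
  rewrite (_ : iota 0 i = index_iota 0 i) ?big_mkord; last by rewrite /index_iota subn0.
  case: ifP => ki.
    rewrite (bigD1 (Ordinal ki)) //= ki eqxx mulr1 big1 ?addr0 // => j /eqP jk.
    rewrite ltn_ord; case: eqP => [E|_]; last by rewrite mulr0.
    by case: jk; apply: val_inj.
  rewrite big1 // => j _; rewrite ltn_ord; case: eqP => [E|_]; last by rewrite mulr0.
  by move: ki; rewrite E ltn_ord.
rewrite sE mulN1r; case: (ltngtP k i) => ki.
- by rewrite subrr mulr0 subrr normr0 ltW.
- rewrite subr0 sub0r normrN -(subnK (ltnW ki)) exprD mulrCA mulVf // mulr1.
  rewrite ger0_norm ?exprn_ge0 ?(ltW z0) //; apply: le_trans ze.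
  rewrite -{2}(expr1 z); apply: ler_wiXn2l => //; first exact: ltW.
  by rewrite subn_gt0.
- by rewrite subr0 ki mulVf // subrr normr0 ltW.
Qed.

(** The indicator of a vector is a product of indicators of its coordinates.
    They are substituted for powers of the z_j one coordinate at a time. *)
Lemma mean_closed_points (F : (vec -> R) -> Prop) : mean_closed F ->
  (forall z, (forall j, 0 <= z j <= 1) -> F (pgf_fun z)) -> forall k, F (fun x => (x == k)%:R).
Proof.
move=> Fc Fz k; have [FD FZ FL] := Fc.
pose power (f : nat -> R) := exists2 z, 0 <= z <= 1 & f = fun i => z ^+ i.
pose point (f : nat -> R) := exists i, f = fun k : nat => (k == i)%:R.
have b01 f : power f \/ point f -> forall i, 0 <= f i <= 1.
  move=> [[z /andP[z0 z1] ->] i|[i0 ->] i]; first by rewrite exprn_ge0 ?exprn_ile1.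
  by case: eqP; rewrite /= ?lexx ?ler01.
have main m : (m <= n)%N -> forall phi : 'I_n -> nat -> R,
    (forall j : 'I_n, (j < m)%N -> power (phi j) \/ point (phi j)) ->
    (forall j : 'I_n, (m <= j)%N -> power (phi j)) ->
    F (fun x => \prod_j phi j (tnth x j)).
  elim: m => [|m IH] mn phi lo hi.
    have [z zP] := choice (fun j => let: ex_intro2 z a b :=
        hi j (leq0n _) in ex_intro (fun z => 0 <= z <= 1 /\ phi j = fun i =>
            z ^+ i) z (conj a b)).
    rewrite (_ : (fun x => _) = pgf_fun z); first by apply: (Fz) => j; case: (zP j).
    by apply/funext => x; apply: eq_bigr => j _; case: (zP j) => _ ->.
  pose j0 := Ordinal mn.
  pose psi (x : vec) := \prod_(j | j != j0) phi j (tnth x j).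
  have psi1 x : `|psi x| <= 1.
    rewrite ger0_norm.
      apply: prodr_ile1 => j _; apply: b01.
      by case: (ltnP j m.+1) => jm; [exact: lo|left; exact: hi].
    apply: prodr_ge0 => j _; have := @b01 (phi j).
    case: (ltnP j m.+1) => jm; first by move=> /(_ (lo _ jm) (tnth x j))/andP[].
    by move=> /(_ (or_introl (hi _ jm)) (tnth x j))/andP[].
  pose F1 (f : nat -> R) := F (fun x => psi x * f (tnth x j0)).
  have F1c : mean_closed F1.
    split.
    - move=> f g Ff Fg; rewrite /F1 (_ : (fun x => _) = fun x =>
        psi x * f (tnth x j0) + psi x * g (tnth x j0)); first exact: FD.
      by apply/funext => x; rewrite mulrDr.
    - move=> c f Ff; rewrite /F1 (_ : (fun x => _) = fun x => c * (psi x * f (tnth x j0)));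
        first exact: FZ.
      by apply/funext => x; rewrite mulrCA.
    - move=> f Ff; apply: (FL) => e e0; have [g Fg fg] := Ff e e0.
      exists (fun x => psi x * g (tnth x j0)) => // x.
      rewrite -mulrBr normrM; apply: le_trans (fg (tnth x j0)).
      by rewrite ler_piMl.
  have F1z z : 0 <= z <= 1 -> F1 (fun i => z ^+ i).
    move=> z01; rewrite /F1.
    pose phi' j := if j == j0 then (fun i => z ^+ i) else phi j.
    rewrite (_ : (fun x => _) = fun x => \prod_j phi' j (tnth x j)); last first.
      apply/funext => x; rewrite [RHS](bigD1 j0) //= {1}/phi' eqxx mulrC; congr (_ * _).
      by apply: eq_bigr => j /negbTE jj; rewrite /phi' jj.
    apply: (IH); first exact: ltnW.
    - move=> j jm; rewrite /phi'; case: eqP => _; first by left; exists z.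
      by apply: (lo); exact: ltnW.
    - move=> j mj; rewrite /phi'; case: eqP => jj; first by exists z.
      apply: (hi); rewrite ltn_neqAle mj andbT; apply/eqP => E.
      by apply: jj; apply: val_inj.
  rewrite (_ : (fun x => _) = fun x => psi x * phi j0 (tnth x j0)); last first.
    by apply/funext => x; rewrite (bigD1 j0) //= mulrC.
  have [[z z01 ->]|[i ->]] := lo j0 (ltnSn m); first exact: F1z.
  exact: (mean_closed_point F1c F1z i).
rewrite (_ : (fun x => _) = fun x : vec => \prod_j (tnth x j == tnth k j)%:R).
  apply: (main n (leqnn n) (fun j i => (i == tnth k j)%:R)).
    by move=> j _; right; exists (tnth k j).
  by move=> j; rewrite leqNgt ltn_ord.
apply/funext => x; case: eqP => [->|xk].
  by rewrite big1 // => j _; rewrite eqxx.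
apply/esym/eqP; rewrite prodf_seq_eq0; apply/hasP.
have [j xj] : exists j, tnth x j != tnth k j.
  apply/existsP; apply: contraT => /existsPn E; case: xk; apply: eq_from_tnth => j.
  by have := E j; rewrite negbK => /eqP.
by exists j; [exact: mem_index_enum|rewrite (negbTE xj) /= eqxx].
Qed.
End CountVectors.

Section PointSum.
Context {R : realType}.
Variables (n : nat) (p : n.-tuple nat -> R).
Hypothesis p0 : forall k, 0 <= p k.
Local Open Scope ereal_scope.

Definition point_sum (A : set (n.-tuple nat)) : \bar R := \esum_(k in A) (p k)%:E.

Let point_sum0 : point_sum set0 = 0.
Proof. exact: esum_set0. Qed.

Let point_sum_ge0 A : 0 <= point_sum A.
Proof. by apply: esum_ge0 => k _; rewrite lee_fin. Qed.

Let point_sum_sigma_additive : semi_sigma_additive point_sum.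
Proof.
move=> F mF tF mUF; apply: cvg_toP.
  apply: ereal_nondecreasing_is_cvgn => a b ab.
  by apply: lee_sum_nneg_natr => // i _ _; exact: point_sum_ge0.
by rewrite /point_sum nneseries_sum_bigcup // => k; rewrite lee_fin.
Qed.

HB.instance Definition _ := isMeasure.Build _ _ _ point_sum
  point_sum0 point_sum_ge0 point_sum_sigma_additive.

Definition point_measure : {measure set (n.-tuple nat) -> \bar R} := point_sum.

Lemma point_measure1 k : point_measure [set k] = (p k)%:E.
Proof. by rewrite /point_measure /= /point_sum esum_set1 // lee_fin. Qed.
End PointSum.

Lemma cvg_sumr (R : realType) (I : Type) (s : seq I) (f : I -> nat -> R) (l : I -> R) :
  (forall i, f i d @[d --> \oo] --> l i) ->
  \sum_(i <- s) f i d @[d --> \oo] --> \sum_(i <- s) l i.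
Proof.
move=> fl; elim: s => [|i s IH].
  rewrite big_nil; under eq_fun do rewrite big_nil; exact: cvg_cst.
rewrite big_cons; under eq_fun do rewrite big_cons; exact: cvgD.
Qed.

Lemma weak_dist_bound (R : realFieldType) (M e a a' s s' m m' : R) : 0 <= M ->
  1 - m <= e / (4 * (M + 1)) -> `|m - m'| <= e / (4 * (M + 1)) ->
  `|a - s| <= M * (1 - m) -> `|a' - s'| <= M * (1 - m') -> `|s - s'| <= e / 4 ->
  `|a - a'| <= e.
Proof.
move=> M0; set e' := e / _ => h1 h2 h3 h4 h5.
have e'0 : 0 <= e' by apply: le_trans h2.
have Me : M * e' <= e / 4.
  have -> : e / 4 = (M + 1) * e' by rewrite /e'; field; lra.
  by rewrite ler_wpM2r // lerDl.
have h6 : M * (1 - m) <= e / 4 by apply: le_trans Me; apply: ler_wpM2l.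
have h7 : M * (1 - m') <= e / 4 + e / 4.
  apply: (@le_trans _ _ (M * (e' + e'))); last by rewrite mulrDr; apply: lerD.
  apply: ler_wpM2l => //; move: h2; rewrite ler_norml => /andP[_ ?]; lra.
move: h3 h4 h5; rewrite !ler_norml => /andP[? ?] /andP[? ?] /andP[? ?].
by apply/andP; split; lra.
Qed.

Section WeakLimit.
Context {R : realType}.
Variable n : nat.
Notation vec := (n.-tuple nat).
Implicit Types P Q : probability vec R.

Definition vec_box (K : nat) : set vec := [set x | forall j, (tnth x j < K)%N].

Definition vec_of K (u : {ffun 'I_n -> 'I_K}) : vec := [tuple (u j : nat) | j < n].

Definition point_fun (k : vec) : vec -> R := fun x => (x == k)%:R.

Lemma point_indic k x : \1_[set k] x = point_fun k x.
Proof.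
rewrite indicE /point_fun; congr (_%:R); congr nat_of_bool.
by apply/idP/eqP => [/set_mem|->]; [|exact: mem_set].
Qed.

Lemma box_point_fun K x : \sum_(u : {ffun 'I_n ->
    'I_K}) point_fun (vec_of u) x = \1_(vec_box K) x.
Proof.
rewrite indicE /point_fun; case: (asboolP (vec_box K x)) => [xK|xK].
  rewrite (mem_set xK) (bigD1 [ffun j => Ordinal (xK j)]) //= big1.
    rewrite addr0; case: eqP => // -[]; apply: eq_from_tnth => j.
    by rewrite tnth_mktuple ffunE.
  move=> u /eqP uN; case: eqP => // E; case: uN; apply/ffunP => j.
  by apply: val_inj; rewrite ffunE /= E tnth_mktuple.
rewrite memNset // big1 // => u _; case: eqP => // E; case: xK => j.
by rewrite E tnth_mktuple.
Qed.

Lemma measure_box (mu : {measure set vec -> \bar R}) K :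
  mu (vec_box K) = (\sum_(u : {ffun 'I_n -> 'I_K}) mu [set vec_of u])%E.
Proof.
have m (A : set vec) : measurable A by exact: measurable_vec.
have mf (f : vec -> \bar R) : measurable_fun setT f by move=> _ Y _; exact: measurable_vec.
rewrite -(setIT (vec_box K)) -integral_indic //.
under eq_integral do rewrite -box_point_fun -sumEFin.
rewrite ge0_integral_sum //; last by move=> u x _; rewrite lee_fin.
apply: eq_bigr => u _; rewrite -[in RHS](setIT [set vec_of u]) -integral_indic //.
by apply: eq_integral => x _; rewrite point_indic.
Qed.

Lemma bounded_point_fun k : bounded_meas (point_fun k).
Proof.
apply: bounded_test_meas; exists 1 => x; rewrite /point_fun.
by case: eqP; rewrite ?normr1 ?normr0.
Qed.

Lemma prob_point P k : P [set k] = (mean P (point_fun k))%:E.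
Proof.
rewrite -mean_EFin; last exact: bounded_point_fun.
rewrite -[in LHS](setIT [set k]) -integral_indic //; last exact: measurable_vec.
by apply: eq_integral => x _; rewrite point_indic.
Qed.

Definition box_mass P K : R := \sum_(u : {ffun 'I_n -> 'I_K}) mean P (point_fun (vec_of u)).

Lemma box_massE P K : P (vec_box K) = (box_mass P K)%:E.
Proof.
rewrite (measure_box P) /box_mass -sumEFin.
by apply: eq_bigr => u _; exact: prob_point.
Qed.

Lemma box_cover : \bigcup_K vec_box K = setT.
Proof.
apply/seteqP; split=> // x _; exists (\max_j tnth x j).+1 => //= j.
by rewrite ltnS; exact: (bigop.leq_bigmax (F := fun j => tnth x j) j).
Qed.

Lemma box_cvg (mu : {measure set vec -> \bar R}) :
  (mu (vec_box K) @[K --> \oo] --> mu setT)%E.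
Proof.
rewrite -box_cover; apply: nondecreasing_cvg_mu => [K||K K' KK']; try exact: measurable_vec.
by apply/subsetPset => x xK j; apply: leq_trans (xK j) KK'.
Qed.

Lemma box_mass_le1 P K : box_mass P K <= 1.
Proof. by rewrite -lee_fin -box_massE; exact: probability_le1 (measurable_vec _). Qed.

Lemma box_mass_near1 P (e : R) : 0 < e -> exists K, 1 - box_mass P K <= e.
Proof.
move=> e0; have H : (P (vec_box K) @[K --> \oo] --> 1)%E.
  by rewrite -(probability_setT P); exact: (@box_cvg P).
move: H; under eq_fun do rewrite box_massE.
move=> /fine_cvgP[_] /cvgrPdist_le/(_ e e0)[K _ /(_ K (leqnn K))] /= H.
by exists K; apply: le_trans H; exact: ler_norm.
Qed.

Lemma mean_box_approx P (f : vec -> R) (M : R) K : (forall x, `|f x| <= M) ->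
  `|mean P f - \sum_(u : {ffun 'I_n ->
      'I_K}) f (vec_of u) * mean P (point_fun (vec_of u))| <= M * (1 - box_mass P K).
Proof.
move=> fM.
have bf : bounded_meas f by apply: bounded_test_meas; exists M.
have bp u := bounded_point_fun (@vec_of K u).
have bpc (u : {ffun 'I_n -> 'I_K}) := bounded_measZ (f (vec_of u)) (bp u).
have bS := bounded_meas_sum (index_enum {ffun 'I_n -> 'I_K}) xpredT bpc.
have b1 := bounded_meas_sum (index_enum {ffun 'I_n -> 'I_K}) xpredT bp.
rewrite (_ : \sum_u _ = mean P (fun x =>
    \sum_(u : {ffun 'I_n -> 'I_K}) f (vec_of u) * point_fun (vec_of u) x)); last first.
  by rewrite mean_sum //; apply: eq_bigr => u _; rewrite meanZ.
have sE x : \sum_(u : {ffun 'I_n ->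
    'I_K}) f (vec_of u) * point_fun (vec_of u) x = f x * \1_(vec_box K) x.
  rewrite -box_point_fun mulr_sumr; apply: eq_bigr => u _.
  by rewrite /point_fun; case: eqP => [->|]; rewrite ?mulr0.
rewrite -meanB // (_ : 1 - _ = mean P (fun x => 1 - \1_(vec_box K) x)); last first.
  rewrite meanB ?mean_cst; [|exact: bounded_meas_cst|].
    congr (_ - _); rewrite /box_mass -mean_sum //.
    by congr mean; apply/funext => x; rewrite box_point_fun.
  by rewrite (_ : \1_(vec_box K) = fun x =>
      \sum_(u : {ffun 'I_n -> 'I_K}) point_fun (vec_of u) x) //; apply/funext => x;
          rewrite box_point_fun.
have bi : bounded_meas (fun x : vec => 1 - \1_(vec_box K) x : R).
  apply: bounded_test_meas; exists 1 => x; rewrite indicE; case: (_ \in _) => /=.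
    by rewrite subrr normr0.
  by rewrite subr0 normr1.
rewrite -meanZ //; apply: mean_norm_le.
- by apply: bounded_test_meas; exists (M + M) => x; rewrite sE indicE;
    case: (_ \in _); rewrite ?mulr1 ?mulr0 ?subrr ?subr0 ?normr0; have := fM x;
        have := normr_ge0 (f x); lra.
- exact: bounded_measZ.
- move=> x; rewrite sE indicE; case: (_ \in _) => /=.
    by rewrite mulr1 !subrr normr0 mulr0.
  by rewrite mulr0 !subr0 mulr1.
Qed.

Lemma weak_cvg_points (P : nat -> probability vec R) Q :
  (forall k, mean (P d) (point_fun k) @[d --> \oo] --> mean Q (point_fun k)) -> weak_cvg P Q.
Proof.
move=> PQ f bf; have [M fM] := bf.
have M0 : 0 <= M by apply: le_trans (fM [tuple 0%N | j < n]).
rewrite (mean_EFin Q (bounded_test_meas bf)).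
under eq_fun do rewrite (mean_EFin _ (bounded_test_meas bf)).
apply/fine_cvgP; split; first by near=> d.
apply/cvgrPdist_le => e e0 /=.
have e1 : 0 < e / (4 * (M + 1)) by rewrite divr_gt0 // mulr_gt0 //; lra.
have [K QK] := box_mass_near1 Q e1.
pose S P := \sum_(u : {ffun 'I_n -> 'I_K}) f (vec_of u) * mean P (point_fun (vec_of u)).
have cS : S (P d) @[d --> \oo] --> S Q.
  by apply: cvg_sumr => u; apply: cvgM; [exact: cvg_cst|exact: PQ].
have cm : box_mass (P d) K @[d --> \oo] --> box_mass Q K.
  by apply: cvg_sumr => u; exact: PQ.
have e4 : 0 < e / 4 by lra.
near=> d.
apply: (weak_dist_bound (e := e) M0 _ _ (mean_box_approx Q K fM) (mean_box_approx (P d) K fM)).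
- exact: QK.
- by near: d; move/cvgrPdist_le : cm => /(_ _ e1).
- by near: d; move/cvgrPdist_le : cS => /(_ _ e4).
Unshelve. all: by end_near. Qed.
Lemma weak_cvg_mean (P : nat -> probability vec R) Q (f : vec -> R) : bounded_test f ->
  weak_cvg P Q -> mean (P d) f @[d --> \oo] --> mean Q f.
Proof.
move=> bf PQ; have := PQ f bf.
rewrite (mean_EFin Q (bounded_test_meas bf)).
under eq_fun do rewrite (mean_EFin _ (bounded_test_meas bf)).
by move=> /fine_cvgP[_].
Qed.

(** The limits of the point masses define a measure, and tightness prevents any
    mass from escaping. *)
Lemma weak_limit_of_points (P : nat -> probability vec R) :
  (forall k, cvgn (fun d => mean (P d) (point_fun k))) ->
  (forall e, 0 < e -> exists K, \forall d \near \oo, 1 - box_mass (P d) K <= e) ->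
  exists Q, weak_cvg P Q.
Proof.
move=> Pc tight.
pose p k : R := limn (fun d => mean (P d) (point_fun k)).
have p0 k : 0 <= p k.
  apply: limr_ge; first exact: Pc.
  by apply: nearW => d; apply: mean_ge0 => x; rewrite /point_fun; case: eqP.
pose mu := point_measure p0.
have muE K : mu (vec_box K) = (\sum_(u : {ffun 'I_n -> 'I_K}) p (vec_of u))%:E.
  by rewrite measure_box -sumEFin; apply: eq_bigr => u _; exact: point_measure1.
have massc K : box_mass (P d) K @[d --> \oo] --> \sum_(u : {ffun 'I_n -> 'I_K}) p (vec_of u).
  by apply: cvg_sumr => u; exact: Pc.
have le1 K : (mu (vec_box K) <= 1)%E.
  rewrite muE lee_fin; apply: (ler_cvg_to (massc K) (cvg_cst (1 : R))).
  by apply: nearW => d; exact: box_mass_le1.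
have mu1 : mu setT = 1%E.
  have cvb := @box_cvg mu.
  have mu_le1 : (mu setT <= 1)%E.
    rewrite -(cvg_lim _ cvb) //; apply: lime_le; first by apply/cvg_ex; exists (mu setT).
    exact: nearW.
  apply/eqP; rewrite eq_le mu_le1 /=.
  apply/lee_addgt0Pr => e e0; have [K tK] := tight e e0.
  apply: (@le_trans _ _ (mu (vec_box K) + e%:E)%E); last first.
    by apply: leeD => //; apply: le_measure; rewrite ?inE //; exact: measurable_vec.
  rewrite muE -EFinD lee_fin -lerBlDr.
  have mc : 1 - e @[d --> \oo] --> 1 - e by exact: cvg_cst.
  apply: (ler_cvg_to mc (massc K)).
  by apply: filterS tK => d; lra.
(* As mu has mass 1, normalizing it only turns it into a probability. *)
pose Q : probability vec R := mnormalize mu (P 0%N).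
have QE A : Q A = mu A.
  by rewrite /Q /= /mnormalize mu1 /= onee_eq0 /= invr1 mule1.
exists Q; apply: weak_cvg_points => k.
have -> : mean Q (point_fun k) = p k.
  by apply: EFin_inj; rewrite -prob_point QE; exact: point_measure1.
exact: Pc.
Qed.

Lemma mean_cvg_closed (P : nat -> probability vec R) :
  mean_closed (fun f : vec -> R => bounded_test f /\ cvgn (fun d => mean (P d) f)).
Proof.
have bm f : bounded_test f -> bounded_meas f by exact: bounded_test_meas.
split.
- move=> f g [[M fM] cf] [[M' gM] cg]; split.
    by exists (M + M') => x; apply: le_trans (ler_normD _ _) _; exact: lerD.
  rewrite (_ : (fun d => _) = fun d => mean (P d) f + mean (P d) g); first exact: is_cvgD.
  by apply/funext => d; rewrite meanD //; apply: bm; [exists M|exists M'].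
- move=> c f [[M fM] cf]; split.
    by exists (`|c| * M) => x; rewrite normrM ler_wpM2l.
  rewrite (_ : (fun d => _) = fun d => c * mean (P d) f).
    by apply: is_cvgM => //; exact: is_cvg_cst.
  by apply/funext => d; rewrite meanZ //; apply: bm; exists M.
- move=> f app.
  have bf : bounded_test f.
    have [g [[M gM] _] fg] := app 1 ltr01; exists (1 + M) => x.
    by rewrite -(subrK (g x) (f x)); apply: le_trans (ler_normD _ _) _; apply: lerD.
  split => //; apply: cauchy_cvg; apply: cauchy_exP => e e0.
  have e2 : 0 < e / 4 by rewrite divr_gt0.
  have [g [bg cg] fg] := app _ e2.
  exists (limn (fun d => mean (P d) g)).
  move/cvgrPdist_le : cg => /(_ _ e2) H.
  suff : \forall d \near \oo, ball (limn (fun d => mean (P d) g)) e (mean (P d) f) by [].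
  apply: filterS H => d h1; rewrite /ball /=.
  have h2 : `|mean (P d) f - mean (P d) g| <= e / 4.
    rewrite -meanB; [|exact: bm|exact: bm].
    rewrite -[X in _ <= X](mean_cst (P d)); apply: mean_norm_le => //.
    - rewrite (_ : (fun x => _) = fun x => f x + (-1) * g x); last by apply/funext => x;
        rewrite mulN1r.
      by apply: bounded_measD; [exact: bm|apply: bounded_measZ; exact: bm].
    - exact: bounded_meas_cst.
  move: h1 h2; rewrite ltr_norml !ler_norml => /andP[? ?] /andP[? ?].
  by apply/andP; split; lra.
Qed.

Lemma weak_limit_of_pgf (P : nat -> probability vec R) :
  (forall z, (forall j, 0 <= z j <= 1) -> cvgn (fun d => mean (P d) (pgf_fun z))) ->
  (forall e, 0 < e -> exists K, \forall d \near \oo, 1 - box_mass (P d) K <= e) ->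
  exists Q, weak_cvg P Q.
Proof.
move=> Pz; apply: weak_limit_of_points => k.
have H z : (forall j, 0 <= z j <= 1) -> bounded_test (pgf_fun z) /\ cvgn (fun d =>
    mean (P d) (pgf_fun z)).
  by move=> z01; split; [exact: bounded_pgf_fun|exact: Pz].
by case: (mean_closed_points (mean_cvg_closed P) H k).
Qed.

(** Along the sequence that alternates between Q and Q', the means of the
    functions [pgf_fun z] converge, hence so do those of the indicators. *)
Lemma pgf_determines (Q Q' : probability vec R) :
  (forall z, (forall j, 0 <= z j <= 1) -> mean Q (pgf_fun z) = mean Q' (pgf_fun z)) ->
  forall k, mean Q (point_fun k) = mean Q' (point_fun k).
Proof.
move=> QQ k; pose P d := if odd d then Q else Q'.
have H : cvgn (fun d => mean (P d) (point_fun k)).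
  have Hz z : (forall j, 0 <= z j <= 1) -> bounded_test (pgf_fun z) /\ cvgn (fun d =>
      mean (P d) (pgf_fun z)).
    move=> z01; split; first exact: bounded_pgf_fun.
    rewrite (_ : (fun d => _) = fun=> mean Q (pgf_fun z)); first exact: is_cvg_cst.
    by apply/funext => d; rewrite /P; case: odd; rewrite ?QQ.
  by case: (mean_closed_points (mean_cvg_closed P) Hz k).
apply/eqP; rewrite -subr_eq0 -normr_le0; apply/ler_addgt0Pr => e e0; rewrite add0r.
have e2 : 0 < e / 2 by lra.
move/cvgrPdist_le : H => /(_ _ e2)[N _ H].
have a : `|limn (fun d => mean (P d) (point_fun k)) - mean (P N.*2) (point_fun k)| <= e / 2.
  by apply: H; rewrite /= -addnn leq_addr.
have b : `|limn (fun d => mean (P d) (point_fun k)) - mean (P N.*2.+1) (point_fun k)| <= e / 2.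
  by apply: H; rewrite /= -addnn -addnS leq_addr.
move: a b; rewrite /P /= odd_double /= !ler_norml => /andP[? ?] /andP[? ?].
by apply/andP; split; lra.
Qed.
End WeakLimit.

(** * The generating function of a Poisson vector *)

Lemma integral_tuple_prod (R : realType) disp (T : measurableType disp) n
    (P : 'I_n -> probability T R) (phi : 'I_n -> T -> R) (I : 'I_n -> R) :
  (forall j, measurable_fun setT (phi j)) -> (forall j x, 0 <= phi j x) ->
  (forall j, \int[P j]_x (phi j x)%:E = (I j)%:E)%E ->
  (\int[tuple_prob P]_t (\prod_j phi j (tnth t j))%:E = (\prod_j I j)%:E)%E.
Proof.
elim: n P phi I => [|n IH] P phi I mphi phi0 PI.
  under eq_integral do rewrite big_ord0; rewrite big_ord0; exact: integral_prob_cst.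
have mprod m (psi : 'I_m -> T -> R) : (forall j, measurable_fun setT (psi j)) ->
    measurable_fun setT (fun t : m.-tuple T => (\prod_j psi j (tnth t j))%:E).
  move=> mpsi; apply/measurable_EFinP; apply: measurable_prod => j _.
  by apply: measurableT_comp => //; exact: measurable_tnth.
rewrite integral_tuple_probS //; first last.
- by move=> t; rewrite lee_fin prodr_ge0.
- exact: mprod.
have I0 : 0 <= \prod_(j < n) I (lift ord0 j).
  apply: prodr_ge0 => j _; rewrite -lee_fin -PI; apply: integral_ge0 => x _.
  by rewrite lee_fin.
transitivity (\int[P ord0]_x ((\prod_(j < n) I (lift ord0 j))%:E * (phi ord0 x)%:E))%E.
  apply: eq_integral => x _.
  rewrite -(IH (fun j => P (lift ord0 j)) (fun j => phi (lift ord0 j)) (fun j =>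
      I (lift ord0 j))) // muleC.
  rewrite -ge0_integralZl //.
  - apply: eq_integral => t _; rewrite big_ord_recl EFinM /= tnth0; congr (_ * (_)%:E)%E.
    by apply: eq_bigr => j _; rewrite tnthS.
  - by apply: (mprod n (fun j => phi (lift ord0 j))) => j.
  - by move=> t _; rewrite lee_fin prodr_ge0.
  - by rewrite lee_fin.
rewrite ge0_integralZl //.
- by rewrite PI big_ord_recl -EFinM mulrC.
- exact/measurable_EFinP.
- by move=> x _; rewrite lee_fin.
Qed.

Section Poisson.
Context {R : realType}.

Lemma poisson_point (s : R) k : 0 < s ->
  poisson_prob s 0 [set k] = (s ^+ k / (k`!)%:R * expR (- s))%:E.
Proof.
move=> s0; rewrite /poisson_prob s0 esum_set1 ?lee_fin ?poisson_pmf_ge0 //.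
by rewrite /poisson_pmf s0.
Qed.

Lemma integral_poisson_pow (s z : R) : 0 < s -> 0 <= z ->
  (\int[poisson_prob s 0]_k (z ^+ k)%:E = (expR (- (s * (1 - z))))%:E)%E.
Proof.
move=> s0 z0.
have cover : \bigcup_k [set k] = [set: nat] by apply/seteqP; split=> // k _; exists k.
rewrite -[X in (\int[_]_(_ in X) _)%E]cover ge0_integral_bigcup //; first last.
- by move=> i j _ _ [x [/= -> ->]].
- by move=> k _; rewrite lee_fin exprn_ge0.
transitivity (\sum_(k <oo) ((expR (- s))%:E * (exp_coeff (s * z) k)%:E))%E.
  apply: eq_eseriesr => k _.
  rewrite (eq_integral (cst (z ^+ k)%:E)); last by move=> x; rewrite inE /= => ->.
  rewrite integral_cst //= poisson_point // -!EFinM; congr (_%:E).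
  by rewrite /exp_coeff /= exprMn; ring.
rewrite nneseriesZl; last by move=> k _; rewrite lee_fin exp_coeff_ge0 // mulr_ge0 // ltW.
have -> : (\sum_(k <oo) (exp_coeff (s * z) k)%:E = (expR (s * z))%:E)%E.
  rewrite /expR -EFin_lim; last exact: is_cvg_series_exp_coeff.
  by apply/congr_lim/funext => m /=; rewrite /series /= sumEFin.
by rewrite -EFinM -expRD; congr (expR _)%:E; ring.
Qed.

Lemma mean_poisson_vec n (sigma z : 'I_n -> R) :
  (forall j, 0 < sigma j) -> (forall j, 0 <= z j <= 1) ->
  mean (poisson_vec sigma) (pgf_fun z) = expR (- \sum_j sigma j * (1 - z j)).
Proof.
move=> s0 z01; apply: EFin_inj.
rewrite -mean_EFin; last exact/bounded_test_meas/bounded_pgf_fun.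
rewrite /pgf_fun (@integral_tuple_prod R _ nat n _ (fun j k => z j ^+ k) (fun j =>
    expR (- (sigma j * (1 - z j))))).
- by rewrite -sumrN expR_sum.
- by move=> j.
- by move=> j k; rewrite exprn_ge0 //; case/andP: (z01 j).
- by move=> j; apply: integral_poisson_pow => //; case/andP: (z01 j).
Qed.
End Poisson.

(** * Periodic arcs and their weights *)

Section Arcs.
Context {R : realType}.
Notation RT := (measurableTypeR R).
Let U : probability RT R := uniform_prob (@ltr01 R).

Lemma arc_periodic (xi tau sigma : R) N t (m : int) :
  in_arc xi tau sigma N (t + m%:~R) = in_arc xi tau sigma N t.
Proof.
apply/asboolP/asboolP => -[j jP].
  by exists (m + j); rewrite rmorphD /= addrA.
by exists (j - m); rewrite rmorphB /= addrCA addrK addrC.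
Qed.

Lemma measurable_arc (xi tau sigma : R) N :
  measurable_fun [set: RT] (fun t => (in_arc xi tau sigma N t)%:R : RT).
Proof.
pose A := \bigcup_(j : int) `](xi + tau / N%:R - j%:~R), (xi + (tau +
    sigma) / N%:R - j%:~R)[%classic : set R.
rewrite (_ : (fun t => _) = \1_A).
  apply: measurable_indic; apply: open_measurable; apply: bigcup_open => j _.
  exact: interval_open.
apply/funext => t; rewrite indicE; congr (_%:R); congr nat_of_bool.
apply/asboolP/idP => [[j jP]|/set_mem[j _]].
  by apply: mem_set; exists j => //=; rewrite in_itv /=; move: jP => /andP[? ?]; apply/andP;
      split; lra.
by rewrite /= in_itv /= => /andP[? ?]; exists j; apply/andP; split; lra.
Qed.

Lemma bounded_arc (xi tau sigma : R) N :
  bounded_meas (fun t : RT => (in_arc xi tau sigma N t)%:R : R).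
Proof.
split; first exact: measurable_arc.
by exists 1 => t; case: in_arc; rewrite ?normr1 ?normr0.
Qed.

(** By periodicity the arc may be moved to ]0, sigma / N[, which lies in the
    unit interval. *)
Lemma mean_arc (xi tau sigma : R) N : (0 < N)%N -> 0 <= sigma <= N%:R ->
  mean U (fun t => (in_arc xi tau sigma N t)%:R) = sigma / N%:R.
Proof.
move=> N0 /andP[s0 sN]; apply: EFin_inj; rewrite -mean_EFin; last exact: bounded_arc.
have N0' : 0 < N%:R :> R by rewrite ltr0n.
have sN0 : 0 <= sigma / N%:R by rewrite divr_ge0.
have sN1 : sigma / N%:R <= 1 by rewrite ler_pdivrMr // mul1r.
have m1 : measurable_fun [set: RT] (fun t : RT => (in_arc xi tau sigma N t)%:R%:E : \bar R).
  by apply/measurable_EFinP; exact: measurable_arc.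
rewrite -(integral_periodic_shift (xi + tau / N%:R) m1); last 2 first.
- by move=> t; rewrite lee_fin.
- by move=> t m; rewrite arc_periodic.
rewrite (@integral_01_co R (fun t => (in_arc xi tau sigma N (t + (xi + tau / N%:R)))%:R%:E));
    last 2 first.
- exact: (measurableT_comp m1 (measurable_shift _)).
- by move=> t; rewrite lee_fin.
transitivity (\int[@lebesgue_measure R]_(t in `[0%R, 1%R[) (\1_(`]0%R, (sigma /
    N%:R)%R[%classic) t)%:E)%E.
  apply: eq_integral => t; rewrite inE /= in_itv /= => /andP[t0 t1].
  rewrite indicE; congr (_%:R%:E); congr nat_of_bool.
  apply/asboolP/idP => [[j /andP[h1 h2]]|/set_mem].
    have j1 : (j%:~R : R) < 1 by rewrite mulrDl in h2; lra.
    have j0 : -1 < (j%:~R : R) by lra.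
    have j0' : j = 0.
      have : `|j%:~R| < 1 :> R by rewrite ltr_norml j0 j1.
      by rewrite -intr_norm -[X in _ < X](mulr1z 1) ltr_int; lia.
    apply: mem_set; rewrite /= in_itv /=; move: h1 h2; rewrite j0' mulrDl addr0 => h1 h2.
    by apply/andP; split; lra.
  rewrite /= in_itv /= => /andP[h1 h2]; exists 0; rewrite addr0 mulrDl.
  by apply/andP; split; lra.
rewrite integral_indic //= setIidl; last first.
  move=> t; rewrite /= !in_itv /= => /andP[h1 h2]; apply/andP; split; lra.
by rewrite lebesgue_measure_itv /= lte_fin; case: ltgtP sN0 => // [_ _|<-];
    rewrite ?sube0 ?oppr0 ?adde0.
Qed.

Section Weights.
Variables (n : nat) (xi tau sigma z : 'I_n -> R) (N : nat).
Hypothesis z01 : forall j, 0 <= z j <= 1.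

Definition miss_factor (t : R) : R :=
  \prod_j z j ^+ in_arc (xi j) (tau j) (sigma j) N t.

(** The complement to 1 of the factor by which a vector m with m . alpha = t
    multiplies the generating function. *)
Definition arc_weight (t : R) : R := 1 - miss_factor t.

Lemma miss_factor01 t : 0 <= miss_factor t <= 1.
Proof.
apply/andP; split.
  by apply: prodr_ge0 => j _; rewrite exprn_ge0 //; case/andP: (z01 j).
by apply: prodr_ile1 => j _; have /andP[h1 h2] := z01 j; rewrite exprn_ge0 // exprn_ile1.
Qed.

Lemma weight01 t : 0 <= arc_weight t <= 1.
Proof. by have /andP[h1 h2] := miss_factor01 t; rewrite /arc_weight; apply/andP; split;
    lra. Qed.

Lemma weight_periodic t (m : int) : arc_weight (t + m%:~R) = arc_weight t.
Proof. by congr (1 - _); apply: eq_bigr => j _; rewrite arc_periodic. Qed.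

Lemma measurable_weight : measurable_fun [set: RT] (arc_weight : RT -> RT).
Proof.
apply: measurable_funB; first exact: measurable_cst.
apply: measurable_prod => j _.
rewrite (_ : (fun t => _) = fun t => 1 + (z j - 1) * (in_arc (xi j) (tau j) (sigma j) N t)%:R);
    last first.
  by apply/funext => t; case: in_arc; rewrite /= ?expr1 ?expr0; ring.
apply: measurable_funD; first exact: measurable_cst.
apply: measurable_funM; first exact: measurable_cst.
exact: measurable_arc.
Qed.

Lemma bounded_weight : bounded_meas (arc_weight : RT -> R).
Proof.
split; first exact: measurable_weight.
by exists 1 => t; have /andP[h0 h1] := weight01 t; rewrite ger0_norm.
Qed.

Lemma mean_weighted_arcs (a : 'I_n -> R) : (0 < N)%N -> (forall j, 0 <= sigma j <= N%:R) ->
  mean U (fun t => \sum_j a j * (in_arc (xi j) (tau j) (sigma j) N t)%:R) =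
  (\sum_j a j * sigma j) / N%:R.
Proof.
move=> N0 sN; rewrite mean_sum; last by move=> j; apply: bounded_measZ; exact: bounded_arc.
by rewrite mulr_suml; apply: eq_bigr => j _; rewrite meanZ ?mean_arc ?mulrA //;
    exact: bounded_arc.
Qed.

Lemma weight_le t : arc_weight t <= \sum_j (1 - z j) * (in_arc (xi j) (tau j) (sigma j) N t)%:R.
Proof.
rewrite /arc_weight /miss_factor.
have step (s : seq 'I_n) : 0 <= \prod_(j <- s) z j ^+ in_arc (xi j) (tau j) (sigma j) N t <=
    1 /\
   1 - \prod_(j <- s) z j ^+ in_arc (xi j) (tau j) (sigma j) N t <=
   \sum_(j <- s) (1 - z j) * (in_arc (xi j) (tau j) (sigma j) N t)%:R.
  elim: s => [|j s [/andP[p0 p1] IH]]; first by rewrite !big_nil subrr ler01 !lexx.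
  rewrite !big_cons; have /andP[z0 z1] := z01 j.
  by case: in_arc => /=; rewrite ?expr1 ?expr0 ?mulr1 ?mulr0 ?mul1r ?add0r;
    move: p0 p1 IH; move: (\prod_(_ <- _) _) (\sum_(_ <- _) _) (z j) z0 z1 =>
        p q y y0 y1 p0 p1 IH;
    split; try (apply/andP; split); nra.
by case: (step (index_enum _)).
Qed.

Lemma mean_weight_le : (0 < N)%N -> (forall j, 0 <= sigma j <= N%:R) ->
  N%:R * mean U arc_weight <= \sum_j (1 - z j) * sigma j.
Proof.
move=> N0 sN; have N0' : 0 < N%:R :> R by rewrite ltr0n.
rewrite mulrC -ler_pdivlMr // -(mean_weighted_arcs (fun j => 1 - z j) N0 sN).
apply: mean_le; [exact: bounded_weight| |exact: weight_le].
by apply: bounded_meas_sum => j; apply: bounded_measZ; exact: bounded_arc.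
Qed.

Lemma mean_weight_disjoint : (0 < N)%N -> (forall j, 0 <= sigma j <= N%:R) ->
  (forall j j' t, j != j' -> in_arc (xi j) (tau j) (sigma j) N t ->
     in_arc (xi j') (tau j') (sigma j') N t -> False) ->
  N%:R * mean U arc_weight = \sum_j (1 - z j) * sigma j.
Proof.
move=> N0 sN disj; have N0' : N%:R != 0 :> R by rewrite pnatr_eq0 -lt0n.
apply: (mulIf (invr_neq0 N0')); rewrite mulrAC mulfV // mul1r.
rewrite -(mean_weighted_arcs (fun j => 1 - z j) N0 sN); congr mean.
apply/funext => t; rewrite /arc_weight /miss_factor.
have [/existsP[j jt]|/existsPn no] := boolP [exists j, in_arc (xi j) (tau j) (sigma j) N t].
  have other i : i != j -> in_arc (xi i) (tau i) (sigma i) N t = false.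
    by move=> ij; apply/negP => it; apply: (disj i j t).
  rewrite (bigD1 j) //= [RHS](bigD1 j) //= jt expr1 mulr1 !big1 ?mulr1 ?addr0 // => i /other ->.
    by rewrite mulr0.
  by rewrite expr0.
rewrite !big1 ?subrr // => j _; have := no j; case: in_arc => // _.
  by rewrite mulr0.
Qed.
End Weights.
End Arcs.

(** * Disjoint and overlapping arcs *)

Section ArcOverlap.
Context {R : realType}.
Notation RT := (measurableTypeR R).
Notation U := (uniform_prob (@ltr01 R) : probability RT R).

(** At a common point of the two arcs, xi - xi' differs from an integer by a
    quantity of order 1 / N. For large N this excludes that xi - xi' is not an
    integer; and if it is one, the difference is 0, so that the two intervals
    have a common point. *)
Lemma arcs_eventually_disjoint (xi tau sigma xi' tau' sigma' : R) :
  (xi - xi' \is a Num.int -> `]tau, (tau + sigma)[ `&` `]tau', (tau' + sigma')[ = set0) ->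
  exists N0 : nat, forall N t, (N0 <= N)%N -> in_arc xi tau sigma N t ->
    in_arc xi' tau' sigma' N t -> False.
Proof.
move=> disj.
have arcP N a b c t : (0 < N)%N -> in_arc a b c N t ->
    exists (k : int) (s : R), b < s < b + c /\ t + k%:~R = a + s / N%:R.
  move=> N0; have N0' : 0 < N%:R :> R by rewrite ltr0n.
  move=> /asboolP[k /andP[h1 h2]]; exists k, ((t + k%:~R - a) * N%:R).
  split; last first.
    by rewrite mulfK ?gt_eqF // [RHS]addrC subrK.
  apply/andP; split; first by rewrite -ltr_pdivrMr //; lra.
  by rewrite -ltr_pdivlMr //; lra.
pose M := `|tau| + `|sigma| + `|tau'| + `|sigma'|.
have M0 : 0 <= M by rewrite !addr_ge0.
have close s s' : tau < s < tau + sigma -> tau' < s' < tau' + sigma' -> `|s' - s| <= M.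
  move=> /andP[h1 h2] /andP[h3 h4]; rewrite /M.
  have := ler_norm tau; have := ler_norm (- tau); have := ler_norm sigma.
  have := ler_norm tau'; have := ler_norm (- tau'); have := ler_norm sigma'.
  have := normr_ge0 sigma; have := normr_ge0 sigma'.
  rewrite !normrN => *; rewrite ler_norml; apply/andP; split; lra.
have [xint|xnint] := boolP (xi - xi' \is a Num.int).
- exists (Num.truncn M).+1 => N t NM; have N0 : (0 < N)%N by apply: leq_trans NM.
  have N0' : 0 < N%:R :> R by rewrite ltr0n.
  have MN : M < N%:R by apply: lt_le_trans (truncnS_gt _) _; rewrite ler_nat.
  move=> /(arcP _ _ _ _ _ N0)[k [s [sP E]]] /(arcP _ _ _ _ _ N0)[k' [s' [s'P E']]].
  have /intrP[p pE] := xint.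
  have key : ((p - (k - k'))%:~R : R) = (s' - s) / N%:R.
    by rewrite !rmorphB /= -pE mulrBl; lra.
  have : `|(p - (k - k'))%:~R| < 1 :> R.
    rewrite key normrM normfV (ger0_norm (ltW N0')) ltr_pdivrMr // mul1r.
    exact: le_lt_trans (close _ _ sP s'P) MN.
  rewrite -intr_norm -[X in _ < X](mulr1z 1) ltr_int => p0.
  have {}p0 : p - (k - k') = 0 by lia.
  have ss : s' = s.
    by apply/eqP; rewrite -subr_eq0; move/eqP: key;
        rewrite p0 eq_sym mulf_eq0 invr_eq0 (gt_eqF N0') orbF.
  have : (`]tau, (tau + sigma)[ `&` `]tau', (tau' + sigma')[) s.
    by split; rewrite /= in_itv //= -ss.
  by rewrite disj.
- set x := xi - xi' in xnint.
  pose delta := Num.min (x - (Num.floor x)%:~R) ((Num.floor x + 1)%:~R - x).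
  have fx : (Num.floor x)%:~R < x.
    rewrite lt_neqAle floor_le_tmp andbT; apply: contra xnint => /eqP <-; exact: intr_int.
  have d0 : 0 < delta by rewrite lt_min !subr_gt0 fx /= floorD1_gt.
  have dist (p : int) : delta <= `|p%:~R - x|.
    rewrite /delta ge_min.
    have [px|px] := leP p (Num.floor x).
      have : (p%:~R : R) <= (Num.floor x)%:~R by rewrite ler_int.
      by move=> h; apply/orP; left; rewrite distrC ler_normr; apply/orP; left; lra.
    have : ((Num.floor x + 1)%:~R : R) <= p%:~R by rewrite ler_int; lia.
    by move=> h; apply/orP; right; rewrite ler_normr; apply/orP; left; lra.
  exists (Num.truncn (M / delta)).+1 => N t NM; have N0 : (0 < N)%N by apply: leq_trans NM.
  have N0' : 0 < N%:R :> R by rewrite ltr0n.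
  have MN : M < N%:R * delta.
    rewrite -ltr_pdivrMr //; apply: lt_le_trans (truncnS_gt _) _; by rewrite ler_nat.
  move=> /(arcP _ _ _ _ _ N0)[k [s [sP E]]] /(arcP _ _ _ _ _ N0)[k' [s' [s'P E']]].
  have key : ((k - k')%:~R : R) - x = - ((s' - s) / N%:R).
    by rewrite !rmorphB /= /x mulrBl; lra.
  have := dist (k - k'); rewrite key normrN normrM normfV (ger0_norm (ltW N0')) leNgt.
  by rewrite ltr_pdivrMr // (le_lt_trans (close _ _ sP s'P)) // mulrC.
Qed.

Lemma all_arcs_eventually_disjoint n (xi tau sigma : 'I_n -> R) :
  (forall j j', j != j' -> xi j - xi j' \is a Num.int ->
     `]tau j, (tau j + sigma j)[ `&` `]tau j', (tau j' + sigma j')[ = set0) ->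
  exists N0 : nat, forall N, (N0 <= N)%N -> forall j j' t, j != j' ->
    in_arc (xi j) (tau j) (sigma j) N t -> in_arc (xi j') (tau j') (sigma j') N t -> False.
Proof.
move=> disj.
have H (p : 'I_n * 'I_n) : exists N0 : nat, p.1 != p.2 -> forall N t, (N0 <= N)%N ->
    in_arc (xi p.1) (tau p.1) (sigma p.1) N t -> in_arc (xi p.2) (tau p.2) (sigma p.2) N t ->
        False.
  case: p => j j' /=; have [//|jj] := eqVneq j j'; first by exists 0%N.
  have [N0 N0P] := arcs_eventually_disjoint (disj j j' jj).
  by exists N0.
have [N1 N1P] := choice H.
exists (\max_p N1 p) => N NN j j' t jj; apply: (N1P (j, j') jj).
by apply: leq_trans NN; exact: (bigop.leq_bigmax (F := N1) (j, j')).
Qed.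

(** The weight is the indicator of the union of two arcs, and their intersection
    contains an arc of length (b - a) / N. *)
Lemma mean_weight_overlap n (xi tau sigma : 'I_n -> R) (j j' : 'I_n) (a b : R) N :
  (forall i, 0 <= sigma i <= N%:R) -> (0 < N)%N -> j != j' -> xi j - xi j' \is a Num.int ->
  a <= b -> tau j <= a -> b <= tau j + sigma j -> tau j' <= a -> b <= tau j' + sigma j' ->
  N%:R * mean U (arc_weight xi tau sigma (fun i => ((i != j) && (i != j'))%:R) N) <=
  sigma j + sigma j' - (b - a).
Proof.
move=> sN N0 jj /intrP[p pE] ab ja bj j'a bj'.
have N0' : 0 < N%:R :> R by rewrite ltr0n.
rewrite mulrC -ler_pdivlMr // !mulrDl mulNr.
have /andP[sj0 sjN] := sN j.
rewrite -(mean_arc (xi j) (tau j) N0 (sN j)) -(mean_arc (xi j') (tau j') N0 (sN j')).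
rewrite -(@mean_arc R (xi j) a (b - a) N N0); last by apply/andP; split; lra.
have b1 := bounded_arc (xi j) (tau j) (sigma j) N.
have b2 := bounded_arc (xi j') (tau j') (sigma j') N.
have b3 := bounded_arc (xi j) a (b - a) N.
have b12 := bounded_measD b1 b2.
rewrite -meanD // -meanB //.
have z01 i : 0 <= (((i != j) && (i != j'))%:R : R) <= 1 by case: (i != j) (i != j') => -[];
    rewrite /= ?lexx ?ler01.
apply: mean_le; first exact: bounded_weight.
  rewrite (_ : (fun t => _) = fun t =>
      ((in_arc (xi j) (tau j) (sigma j) N t)%:R +
          (in_arc (xi j') (tau j') (sigma j') N t)%:R) +
              (-1) * (in_arc (xi j) a (b - a) N t)%:R).
    by apply: bounded_measD => //; exact: bounded_measZ.
  by apply/funext => t; rewrite mulN1r.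
move=> t.
have i1 : in_arc (xi j) a (b - a) N t -> in_arc (xi j) (tau j) (sigma j) N t.
  move=> /asboolP[k /andP[h1 h2]]; apply/asboolP; exists k; apply/andP; split.
    by apply: le_lt_trans h1; rewrite lerD2l ler_pM2r ?invr_gt0.
  by apply: lt_le_trans h2 _; rewrite lerD2l ler_pM2r ?invr_gt0 // addrC subrK.
have i2 : in_arc (xi j) a (b - a) N t -> in_arc (xi j') (tau j') (sigma j') N t.
  move=> /asboolP[k /andP[h1 h2]]; apply/asboolP; exists (k - p).
  have h3 : tau j' / N%:R <= a / N%:R by rewrite ler_pM2r ?invr_gt0.
  have h4 : b / N%:R <= (tau j' + sigma j') / N%:R by rewrite ler_pM2r ?invr_gt0.
  rewrite (_ : a + (b - a) = b) in h2; last by ring.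
  rewrite rmorphB /= -pE.
  by apply/andP; split; lra.
have -> : arc_weight xi tau sigma (fun i => ((i != j) && (i != j'))%:R) N t =
    (in_arc (xi j) (tau j) (sigma j) N t || in_arc (xi j') (tau j') (sigma j') N t)%:R.
  rewrite /arc_weight /miss_factor (bigD1 j) //= (bigD1 j') 1?eq_sym //= !eqxx andbF /=.
  rewrite big1; last by move=> i /andP[-> ->]; rewrite expr1n.
  by do 2! case: in_arc; rewrite /= ?expr0 ?expr1 ?mulr0 ?mul0r ?mulr1 ?mul1r ?subr0 ?subrr.
by move: i1 i2; case: (in_arc (xi j) a _ _ _) => [/(_ isT) -> /(_ isT) ->|_ _];
  do ?case: in_arc; rewrite /=; lra.
Qed.
End ArcOverlap.

(** * The limit laws *)

Lemma pgf_hit_count_vec (R : realType) (d n N L : nat) (xi tau sigma z : 'I_n -> R)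
    (alpha : d.-1.-tuple R) :
  (0 < d.-1)%N -> (0 < N)%N -> (forall j, sigma j <= N%:R) -> (L ^ d.-1 <= N < L.+1 ^ d.-1)%N ->
  pgf_fun z (hit_count_vec N xi tau sigma alpha) =
  \prod_(m : {ffun 'I_d.-1 -> 'I_L}) (1 - hit_weight (arc_weight xi tau sigma z N) m alpha).
Proof.
move=> D0 N0 sN LN; rewrite /pgf_fun.
under eq_bigr do rewrite tnth_mktuple (hit_countE _ _ _ D0 N0 (sN _) LN) -prodrXr.
rewrite exchange_big /=; apply: eq_bigr => m _.
by rewrite /hit_weight /arc_weight /miss_factor subKr.
Qed.

Section LimitLaws.
Context {R : realType}.
Notation RT := (measurableTypeR R).
Notation U := (uniform_prob (@ltr01 R) : probability RT R).
Variables (n : nat) (xi tau sigma : 'I_n -> R).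
Hypothesis sigma_gt0 : forall j, 0 < sigma j.
Variable P : nat -> probability (n.-tuple nat) R.
Hypothesis PE : forall d, (2 <= d)%N -> limit_distribution d xi tau sigma (P d).

Let s := \sum_j sigma j.

Lemma sigma_eventually_le : exists N1 : nat, forall N, (N1 <= N)%N ->
  (0 < N)%N /\ forall j, 0 <= sigma j <= N%:R.
Proof.
exists (Num.truncn s).+1 => N NN; split; first exact: leq_trans NN.
move=> j; rewrite (ltW (sigma_gt0 j)) /=.
apply: (@le_trans _ _ s).
  by rewrite /s (bigD1 j) //= lerDl; apply: sumr_ge0 => i _; exact: ltW.
by apply: le_trans (ltW (truncnS_gt _)) _; rewrite ler_nat.
Qed.

Lemma weighted_sigma_le (z : 'I_n -> R) : (forall j, 0 <= z j <= 1) ->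
  \sum_j (1 - z j) * sigma j <= s.
Proof.
move=> z01; apply: ler_sum => j _; have /andP[h0 h1] := z01 j.
by rewrite ler_piMl ?(ltW (sigma_gt0 j)) // gerBl.
Qed.

(** The exponent is kept for each N instead of its limit: it does not involve d,
    and comparing two dimensions only takes one common large N. *)
Lemma pgf_approx (e : R) : 0 < e -> exists D0 : nat, forall d, (D0 <= d)%N ->
  forall z, (forall j, 0 <= z j <= 1) ->
  exists N0 : nat, forall N, (N0 <= N)%N ->
  `|mean (P d) (pgf_fun z) - expR (- (N%:R * mean U (arc_weight xi tau sigma z N)))| <= e.
Proof.
move=> e0; have e2 : 0 < e / 2 by lra.
have [D0 D0P] := void_prob_limit s e2.
exists (maxn 2 D0.+1) => d; rewrite geq_max => /andP[d2 dD] z z01.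
have dD' : (D0 <= d.-1)%N by lia.
have d0 : (0 < d.-1)%N by lia.
have [L0 L0P] := D0P _ dD'.
have [N1 N1P] := sigma_eventually_le.
(* The uniform law on the cube is one of the laws to which PE applies. *)
have cv := PE d2 (lambda := lebesgue_cube R d.-1) (fun A A0 => A0) (bounded_pgf_fun z01).
rewrite (mean_EFin _ (bounded_test_meas (bounded_pgf_fun z01))) in cv.
have /fine_cvgP[_ /cvgrPdist_le/(_ _ e2)[N2 _ N2P]] := cv.
exists (maxn (maxn N1 (L0 ^ d.-1)) N2) => N;
    rewrite !geq_max => /andP[/andP[/N1P[N0 sN] LN] NN2].
have [L LP] := nat_root_exists N d0.
have L0L : (L0 <= L)%N.
  rewrite -ltnS -(ltn_exp2r _ _ d0); apply: leq_ltn_trans LN _.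
  by case/andP: LP.
pose g := arc_weight xi tau sigma z N.
have mg := measurable_weight xi tau sigma z N.
have g01 := weight01 xi tau sigma N z01.
have gp := weight_periodic xi tau sigma z N.
have GE : (\int[uniform_prob (@ltr01 R)]_t (g t)%:E = (mean U g)%:E)%E.
  by apply: mean_EFin; exact: bounded_weight.
have Gs : N%:R * mean U g <= s.
  by apply: le_trans (mean_weight_le _ _ z01 N0 sN) (weighted_sigma_le z01).
have h1 := L0P L N L0L LP g (mean U g) mg g01 gp GE Gs.
have h2 := N2P N NN2.
have hE : (fine (\int[lebesgue_cube R d.-1]_x (pgf_fun z (hit_count_vec N xi tau sigma
    x))%:E))%E =
   mean (lebesgue_cube R d.-1) (fun a =>
       \prod_(m : {ffun 'I_d.-1 -> 'I_L}) (1 - hit_weight g m a)).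
  rewrite /mean /Rintegral; congr fine; apply: eq_integral => a _; congr (_%:E);
      apply: pgf_hit_count_vec => // j.
  by case/andP: (sN j).
move: h2 h1; rewrite /= hE !ler_norml => /andP[a1 a2] /andP[b1 b2].
by apply/andP; split; move: a1 a2 b1 b2; set x := mean _ _; set y := mean _ _; set w := expR _;
    clear; lra.
Qed.

Lemma pgf_cvg z : (forall j, 0 <= z j <= 1) -> cvgn (fun d => mean (P d) (pgf_fun z)).
Proof.
move=> z01; apply: cauchy_cvg; apply: cauchy_exP => e e0.
have e4 : 0 < e / 4 by lra.
have [D0 D0P] := pgf_approx e4.
exists (mean (P D0) (pgf_fun z)).
suff : \forall d \near \oo, ball (mean (P D0) (pgf_fun z)) e (mean (P d) (pgf_fun z)) by [].
exists D0 => // d /= dD; rewrite /ball /=.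
have [N1 N1P] := D0P d dD z z01; have [N2 N2P] := D0P D0 (leqnn _) z z01.
have := N1P _ (leq_maxl N1 N2); have := N2P _ (leq_maxr N1 N2).
move: (mean (P D0) _) (mean (P d) _) (expR _) => x y w.
rewrite !ler_norml ltr_norml => /andP[? ?] /andP[? ?]; apply/andP; split; lra.
Qed.

(** At (w, ..., w) with w close to 1, the generating function is close to 1
    uniformly in d, whereas [pgf_fun] is at most w^K outside of the box. *)
Lemma box_mass_tight (e : R) : 0 < e ->
    exists K, \forall d \near \oo, 1 - box_mass (P d) K <= e.
Proof.
move=> e0; have e4 : 0 < e / 4 by lra.
have s0 : 0 <= s by apply: sumr_ge0 => j _; exact: ltW.
pose dl : R := Num.min (1 / 2) (e / (4 * (s + 1))).
have dl0 : 0 < dl.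
  by rewrite lt_min; apply/andP; split; [lra|rewrite divr_gt0 // mulr_gt0 //; lra].
have dl1 : dl <= 1 / 2 by rewrite ge_min lexx.
have dls : dl * s <= e / 4.
  apply: (@le_trans _ _ (e / (4 * (s + 1)) * (s + 1))); last by rewrite (_ : _ * _ = e / 4) //;
      field; lra.
  apply: ler_pM => //; [exact: ltW| |by lra].
  by rewrite ge_min lexx orbT.
pose w : R := 1 - dl; pose z := fun _ : 'I_n => w.
have w01 : 0 <= w <= 1 by rewrite /w; apply/andP; split; lra.
have z01 j : 0 <= z j <= 1 by exact: w01.
have [K wK] : exists K, w ^+ K <= e / 2.
  have e2 : 0 < e / 2 by lra.
  have : w ^+ k @[k --> \oo] --> 0.
    by apply: cvg_expr; rewrite ger0_norm; [rewrite /w; lra|case/andP: w01].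
  move/eventually_small_cvg0 => /(_ _ e2)[K HK].
  by exists K; exact: HK.
exists K; have [D0 D0P] := pgf_approx e4; exists D0 => // d /= dD.
have [N0 N0P] := D0P d dD z z01; have [N1 N1P] := sigma_eventually_le.
have [N0' sN] := N1P _ (leq_maxr N0 N1).
have := N0P _ (leq_maxl N0 N1); set N := maxn N0 N1.
have Gs : N%:R * mean U (arc_weight xi tau sigma z N) <= e / 4.
  apply: le_trans (mean_weight_le _ _ z01 N0' sN) _; apply: le_trans dls.
  by rewrite /z /w -mulr_sumr subKr.
have expG : 1 - e / 4 <= expR (- (N%:R * mean U (arc_weight xi tau sigma z N))).
  by apply: le_trans (expR_ge1Dx _); lra.
have low : mean (P d) (pgf_fun z) <= box_mass (P d) K + e / 2.
  have bp u := @bounded_point_fun R n (@vec_of n K u).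
  have b1 := bounded_meas_sum (index_enum {ffun 'I_n -> 'I_K}) xpredT bp.
  rewrite /box_mass -mean_sum // -[X in _ <= _ + X](mean_cst (P d)) -meanD //;
      last exact: bounded_meas_cst.
  apply: mean_le.
  - exact/bounded_test_meas/bounded_pgf_fun.
  - by apply: bounded_measD => //; exact: bounded_meas_cst.
  - move=> x; rewrite box_point_fun indicE.
    have /andP[t0 t1] := pgf_fun01 x z01.
    case: (asboolP (vec_box K x)) => [xK|/existsNP[j /negP]].
      by rewrite mem_set //=; lra.
    rewrite -leqNgt => xj; apply: (@le_trans _ _ (e / 2)); last by rewrite lerDr.
    apply: le_trans wK; have /andP[w0 w1] := w01.
    rewrite /pgf_fun (bigD1 j) //=; apply: (@le_trans _ _ (w ^+ tnth x j)).
      rewrite ler_piMr ?exprn_ge0 //; apply: prodr_ile1 => i _.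
      by rewrite exprn_ge0 // exprn_ile1.
    exact: ler_wiXn2l.
move: expG low; move: (expR _) (mean (P d) _) (box_mass _ _) => q x m h1 h2.
by rewrite ler_norml => /andP[? ?]; lra.
Qed.

Lemma limit_law_exists : exists Q, weak_cvg P Q.
Proof. by apply: weak_limit_of_pgf; [exact: pgf_cvg|exact: box_mass_tight]. Qed.

(** For large N the arcs are disjoint, so that the exponent in [pgf_approx] is
    the one of the Poisson generating function. *)
Lemma poisson_of_disjoint :
  (forall j j' : 'I_n, j != j' -> xi j - xi j' \is a Num.int ->
     `]tau j, (tau j + sigma j)[ `&` `]tau j', (tau j' + sigma j')[ = set0) ->
  weak_cvg P (poisson_vec sigma).
Proof.
move=> disj; have [Q PQ] := limit_law_exists.
suff QP k : mean Q (point_fun k) = mean (poisson_vec sigma) (point_fun k).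
  apply: weak_cvg_points => k; rewrite -QP; apply: weak_cvg_mean => //.
  by exists 1 => x; rewrite /point_fun; case: eqP; rewrite ?normr1 ?normr0.
apply: pgf_determines => z z01; rewrite mean_poisson_vec //.
have cv := weak_cvg_mean (bounded_pgf_fun z01) PQ.
rewrite -(cvg_lim _ cv) //; apply/cvg_lim => //.
apply/cvgrPdist_le => e e0; have [D0 D0P] := pgf_approx e0.
exists D0 => // d /= dD; have [N0 N0P] := D0P d dD z z01.
have [N1 N1P] := sigma_eventually_le; have [N2 N2P] := all_arcs_eventually_disjoint disj.
pose N := maxn N0 (maxn N1 N2).
have [NN0 NN1 NN2] : [/\ (N0 <= N)%N, (N1 <= N)%N & (N2 <= N)%N] by rewrite /N; split; lia.
have [N0' sN] := N1P _ NN1; have := N0P _ NN0.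
rewrite (mean_weight_disjoint z N0' sN (N2P _ NN2)) distrC.
by under eq_bigr do rewrite mulrC.
Qed.

(** With z = 0 at j and j' and z = 1 elsewhere, the generating function is the
    probability that both counts vanish. *)
Lemma disjoint_of_poisson : weak_cvg P (poisson_vec sigma) ->
  forall j j' : 'I_n, j != j' -> xi j - xi j' \is a Num.int ->
     `]tau j, (tau j + sigma j)[ `&` `]tau j', (tau j' + sigma j')[ = set0.
Proof.
move=> PQ j j' jj xint; apply/seteqP; split=> // x [].
rewrite /= !in_itv /= => /andP[x1 x2] /andP[x3 x4].
pose a := Num.max (tau j) (tau j').
pose b := Num.min (tau j + sigma j) (tau j' + sigma j').
have ab : a < b by rewrite gt_max !lt_min; apply/andP; split; apply/andP; split; lra.
have ja : tau j <= a by rewrite le_max lexx.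
have j'a : tau j' <= a by rewrite le_max lexx orbT.
have bj : b <= tau j + sigma j by rewrite ge_min lexx.
have bj' : b <= tau j' + sigma j' by rewrite ge_min lexx orbT.
pose z i : R := ((i != j) && (i != j'))%:R.
have z01 i : 0 <= z i <= 1.
  by rewrite /z; case: (i != j) (i != j') => -[]; rewrite /= ?lexx ?ler01.
have pgfE : mean (poisson_vec sigma) (pgf_fun z) = expR (- (sigma j + sigma j')).
  rewrite mean_poisson_vec // (bigD1 j) //= (bigD1 j') 1?eq_sym //= big1; last first.
    by move=> i /andP[ij ij']; rewrite /z ij ij' subrr mulr0.
  by rewrite /z !eqxx andbF subr0 !mulr1 addr0.
have cv := weak_cvg_mean (bounded_pgf_fun z01) PQ; rewrite pgfE in cv.
suff : expR (- (sigma j + sigma j' - (b - a))) <= expR (- (sigma j + sigma j')).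
  by rewrite ler_expR; lra.
apply/ler_addgt0Pr => e e0; rewrite -lerBlDr.
have [D0 D0P] := pgf_approx e0.
apply: (ler_cvg_to (cvg_cst _) cv).
exists D0 => // d /= dD; have [N0 N0P] := D0P d dD z z01.
have [N1 N1P] := sigma_eventually_le.
have [N0' sN] := N1P _ (leq_maxr N0 N1); have := N0P _ (leq_maxl N0 N1).
have := mean_weight_overlap sN N0' jj xint (ltW ab) ja bj j'a bj'.
rewrite -/z; set G := _ * mean _ _ => GG.
have : expR (- (sigma j + sigma j' - (b - a))) <= expR (- G) by rewrite ler_expR lerN2.
move: (expR _) (expR _) (mean _ _) => q q' y ?.
by rewrite ler_norml => /andP[? ?]; lra.
Qed.
End LimitLaws.

Theorem theorem2 (R : realType) (n : nat) (n_ge1 : (1 <= n)%N)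
    (xi tau sigma : 'I_n -> R) (sigma_gt0 : forall j, 0 < sigma j)
    (P : nat -> probability (n.-tuple nat) R)
    (PE : forall d, (2 <= d)%N -> limit_distribution d xi tau sigma (P d)) :
  (exists Q : probability (n.-tuple nat) R, weak_cvg P Q) /\
  (weak_cvg P (poisson_vec sigma) <->
   forall j j' : 'I_n, j != j' -> xi j - xi j' \is a Num.int ->
     `]tau j, (tau j + sigma j)[ `&` `]tau j', (tau j' + sigma j')[ = set0).
Proof.
split; first exact: (limit_law_exists sigma_gt0 PE).
split; first exact: (disjoint_of_poisson sigma_gt0 PE).
exact: (poisson_of_disjoint sigma_gt0 PE).
Qed.
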